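(* Let $R$ be the integral domain $\mathbb F_2[t,t\sqrt{t+1}]$. Then $\mathrm{gl.dim}(R^\infty)=2$ and $\mathrm{w.dim}(R^\infty)=1$.
   Context: Here $t$ is an indeterminate and $\sqrt{t+1}$ is a square root of $t+1$ in an algebraic closure of $\mathbb F_2(t)$. For a ring $R$ of characteristic $2$ with Frobenius map $F(a)=a^2$, the perfect closure is $R^\infty=\varinjlim(R\xrightarrow{F}R\xrightarrow{F}\cdots)$. $\mathrm{gl.dim}$ is global dimension and $\mathrm{w.dim}$ is weak dimension (supremum of flat dimensions of all modules). *)

(* Defs.v *)
From HB Require Import structures.
From mathcomp Require Import all_boot all_order all_algebra.
From mathcomp Require Import sesquilinear generic_quotient.
From mathcomp Require Import polyXY mxpoly fraction zify boolp.

Set Implicit Arguments.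
Unset Strict Implicit.
Unset Printing Implicit Defensive.

Import GRing.Theory.
Local Open Scope ring_scope.
Local Open Scope quotient_scope.

(* The subring K[x, y] of a field L, where L is an extension of K along f:
   its elements are the values at (x, y) of the polynomials over K in two
   variables. *)
Section Adjoin2.
Variables (K L : fieldType) (f : {rmorphism K -> L}) (x y : L).

Definition adjoin2_pred : {pred L} :=
  fun z => `[< exists p : {poly {poly K}},
                 z = (map_poly (map_poly f) p).[x, y] >].

Lemma adjoin2_subring : subring_closed adjoin2_pred.
Proof.
split.
- by apply/asboolP; exists 1; rewrite rmorph1 !hornerC.
- move=> _ _ /asboolP[p ->] /asboolP[q ->]; apply/asboolP.
  by exists (p - q); rewrite rmorphB !hornerD !hornerN.
- move=> _ _ /asboolP[p ->] /asboolP[q ->]; apply/asboolP.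
  by exists (p * q); rewrite rmorphM !hornerM.
Qed.

HB.instance Definition _ :=
  GRing.isSubringClosed.Build L adjoin2_pred adjoin2_subring.

Record adjoin2 := Adjoin2 {
  adjoin2_val :> L;
  adjoin2_valP : adjoin2_val \in adjoin2_pred }.

HB.instance Definition _ := [isSub for adjoin2_val].
HB.instance Definition _ := [Choice of adjoin2 by <:].
HB.instance Definition _ := [SubChoice_isSubComNzRing of adjoin2 by <:].

Lemma adjoin2_pchar (p : nat) : p \in [pchar K] -> p \in [pchar adjoin2].
Proof.
move=> chK; rewrite inE (pcharf_prime chK) /=; apply/eqP/val_inj.
rewrite (rmorph_nat (\val : adjoin2 -> L)) rmorph0 -(rmorph_nat f).
by rewrite (pcharf0 chK) rmorph0.
Qed.

End Adjoin2.

(* The direct limit of R -phi-> R -phi-> R -phi-> ... .  The pair (n, a)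
   stands for the element a of the n-th copy of R; two pairs are identified
   when they have the same image in the k-th copy for some k. *)
Section TelescopeLimit.
Variables (R : comNzRingType) (phi : {rmorphism R -> R}).
Implicit Types u v w : nat * R.

Definition tele_to (k : nat) u : R := iter (k - u.1) phi u.2.

Definition tele_rel u v : bool :=
  `[< exists k, [/\ u.1 <= k, v.1 <= k & tele_to k u = tele_to k v]%N >].

Lemma iter_phi_zmod n : zmod_morphism (iter n phi).
Proof. by elim: n => // n IHn a b; rewrite !iterS IHn rmorphB. Qed.

Lemma iter_phi_monoid n : monoid_morphism (iter n phi).
Proof.
elim: n => [|n [IH1 IHM]]; first by split.
by split=> [|a b]; rewrite !iterS ?IH1 ?IHM ?rmorph1 ?rmorphM.
Qed.

HB.instance Definition _ n :=
  GRing.isZmodMorphism.Build R R (iter n phi) (iter_phi_zmod n).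
HB.instance Definition _ n :=
  GRing.isMonoidMorphism.Build R R (iter n phi) (iter_phi_monoid n).

Lemma tele_toD k l u : (u.1 <= k)%N ->
  tele_to (l + k) u = iter l phi (tele_to k u).
Proof. by move=> le_uk; rewrite /tele_to -iterD addnBA. Qed.

Lemma tele_relP u v :
  reflect (exists k0, forall k, (k0 <= k)%N -> tele_to k u = tele_to k v)
          (tele_rel u v).
Proof.
apply: (iffP (asboolP _)) => [[k0 [uk vk e]]|[k0 e]].
  by exists k0 => k /subnK <-; rewrite !tele_toD // e.
exists (k0 + (u.1 + v.1))%N; split; last by rewrite e ?leq_addr.
  by rewrite addnCA leq_addr.
by rewrite addnA leq_addl.
Qed.

Lemma tele_rel_equiv : equiv_class_of tele_rel.
Proof.
split=> [u|u v|v u w].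
- by apply/tele_relP; exists 0%N.
- by apply/tele_relP/tele_relP => -[k0 e]; exists k0 => k /e.
- move=> /tele_relP[k1 e1] /tele_relP[k2 e2]; apply/tele_relP.
  by exists (k1 + k2)%N => k lek; rewrite e1 ?e2 //;
    apply: leq_trans lek; rewrite ?leq_addr ?leq_addl.
Qed.

Canonical tele_equiv := EquivRelPack tele_rel_equiv.

Definition tele_lim := {eq_quot tele_rel}.
HB.instance Definition _ : EqQuotient _ tele_rel tele_lim :=
  EqQuotient.on tele_lim.
HB.instance Definition _ := Choice.on tele_lim.

Definition tele_in (n : nat) (a : R) : tele_lim := \pi_tele_lim (n, a).

Lemma tele_eqP u v :
  reflect (exists k0, forall k, (k0 <= k)%N -> tele_to k u = tele_to k v)
          (u == v %[mod tele_lim]).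
Proof. by rewrite eqmodE; apply: tele_relP. Qed.

Lemma tele_eq0 k0 u v :
  (forall k, (k0 <= k)%N -> tele_to k u = tele_to k v) ->
  \pi_tele_lim u = \pi_tele_lim v.
Proof. by move=> e; apply/eqP/tele_eqP; exists k0. Qed.

Definition tele_addp u v :=
  ((u.1 + v.1)%N, iter v.1 phi u.2 + iter u.1 phi v.2).
Definition tele_oppp u := (u.1, - u.2).
Definition tele_mulp u v :=
  ((u.1 + v.1)%N, iter v.1 phi u.2 * iter u.1 phi v.2).

Lemma tele_to_add k u v : (u.1 + v.1 <= k)%N ->
  tele_to k (tele_addp u v) = tele_to k u + tele_to k v.
Proof.
move=> le_k; rewrite /tele_to rmorphD /= -!iterD.
by congr (iter _ _ _ + iter _ _ _); lia.
Qed.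

Lemma tele_to_mul k u v : (u.1 + v.1 <= k)%N ->
  tele_to k (tele_mulp u v) = tele_to k u * tele_to k v.
Proof.
move=> le_k; rewrite /tele_to rmorphM /= -!iterD.
by congr (iter _ _ _ * iter _ _ _); lia.
Qed.

Lemma tele_to_opp k u : tele_to k (tele_oppp u) = - tele_to k u.
Proof. by rewrite /tele_to /= rmorphN. Qed.

Lemma tele_to_cst k n (b : bool) : tele_to k (n, b%:R) = b%:R.
Proof. by rewrite /tele_to /= rmorph_nat. Qed.

Definition tele_add := lift_op2 tele_lim tele_addp.
Definition tele_opp := lift_op1 tele_lim tele_oppp.
Definition tele_mul := lift_op2 tele_lim tele_mulp.

Lemma tele_repr u : exists k0, forall k, (k0 <= k)%N ->
  tele_to k (repr (\pi_tele_lim u)) = tele_to k u.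
Proof. by apply/tele_eqP; rewrite reprK. Qed.

Lemma pi_tele_add : {morph \pi : u v / tele_addp u v >-> tele_add u v}.
Proof.
move=> u v; unlock tele_add.
have [k1 e1] := tele_repr u; have [k2 e2] := tele_repr v.
set u' := repr _ in e1 *; set v' := repr _ in e2 *.
apply: (@tele_eq0 (k1 + k2 + u.1 + v.1 + u'.1 + v'.1)) => k le_k.
by rewrite !tele_to_add ?e1 ?e2 //; lia.
Qed.
Canonical pi_tele_add_morph := PiMorph2 pi_tele_add.

Lemma pi_tele_mul : {morph \pi : u v / tele_mulp u v >-> tele_mul u v}.
Proof.
move=> u v; unlock tele_mul.
have [k1 e1] := tele_repr u; have [k2 e2] := tele_repr v.
set u' := repr _ in e1 *; set v' := repr _ in e2 *.
apply: (@tele_eq0 (k1 + k2 + u.1 + v.1 + u'.1 + v'.1)) => k le_k.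
by rewrite !tele_to_mul ?e1 ?e2 //; lia.
Qed.
Canonical pi_tele_mul_morph := PiMorph2 pi_tele_mul.

Lemma pi_tele_opp : {morph \pi : u / tele_oppp u >-> tele_opp u}.
Proof.
move=> u; unlock tele_opp; have [k1 e1] := tele_repr u.
by apply: (@tele_eq0 k1) => k le_k; rewrite !tele_to_opp e1.
Qed.
Canonical pi_tele_opp_morph := PiMorph1 pi_tele_opp.

Lemma tele_addA : associative tele_add.
Proof.
elim/quotW=> u; elim/quotW=> v; elim/quotW=> w; rewrite !piE.
apply: (@tele_eq0 (u.1 + v.1 + w.1)) => k le_k.
by rewrite !tele_to_add ?addrA //=; lia.
Qed.

Lemma tele_addC : commutative tele_add.
Proof.
elim/quotW=> u; elim/quotW=> v; rewrite !piE.
apply: (@tele_eq0 (u.1 + v.1)) => k le_k.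
by rewrite !tele_to_add 1?addrC //; lia.
Qed.

Lemma tele_add0 : left_id (tele_in 0 0) tele_add.
Proof.
elim/quotW=> u; rewrite /tele_in !piE; apply: (@tele_eq0 u.1) => k le_k.
by rewrite tele_to_add // (tele_to_cst k 0 false) add0r.
Qed.

Lemma tele_addN : left_inverse (tele_in 0 0) tele_opp tele_add.
Proof.
elim/quotW=> u; rewrite /tele_in !piE.
apply: (@tele_eq0 (u.1 + u.1)) => k le_k.
by rewrite tele_to_add // tele_to_opp (tele_to_cst k 0 false) addNr.
Qed.

HB.instance Definition _ :=
  GRing.isZmodule.Build tele_lim tele_addA tele_addC tele_add0 tele_addN.

Lemma tele_mulA : associative tele_mul.
Proof.
elim/quotW=> u; elim/quotW=> v; elim/quotW=> w; rewrite !piE.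
apply: (@tele_eq0 (u.1 + v.1 + w.1)) => k le_k.
by rewrite !tele_to_mul ?mulrA //=; lia.
Qed.

Lemma tele_mulC : commutative tele_mul.
Proof.
elim/quotW=> u; elim/quotW=> v; rewrite !piE.
apply: (@tele_eq0 (u.1 + v.1)) => k le_k.
by rewrite !tele_to_mul 1?mulrC //; lia.
Qed.

Lemma tele_mul1 : left_id (tele_in 0 1) tele_mul.
Proof.
elim/quotW=> u; rewrite /tele_in !piE; apply: (@tele_eq0 u.1) => k le_k.
by rewrite tele_to_mul // (tele_to_cst k 0 true) mul1r.
Qed.

Lemma tele_mulDl : left_distributive tele_mul tele_add.
Proof.
elim/quotW=> u; elim/quotW=> v; elim/quotW=> w; rewrite !piE.
apply: (@tele_eq0 (u.1 + v.1 + w.1 + w.1)) => k le_k.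
rewrite !(tele_to_mul, tele_to_add) /=; [|lia..].
by rewrite mulrDl.
Qed.

Lemma tele_nonzero1 : tele_in 0 1 != tele_in 0 0.
Proof.
apply/eqP => /eqP/tele_eqP[k0 /(_ k0 (leqnn _))] /eqP.
by rewrite (tele_to_cst k0 0 true) (tele_to_cst k0 0 false) oner_eq0.
Qed.

HB.instance Definition _ := GRing.Zmodule_isComNzRing.Build tele_lim
  tele_mulA tele_mulC tele_mul1 tele_mulDl tele_nonzero1.

Lemma tele_in_zmod n : zmod_morphism (tele_in n).
Proof.
move=> a b; rewrite /tele_in -[- \pi_tele_lim _]/(tele_opp _) -[RHS]/(tele_add _ _).
rewrite !piE; apply: (@tele_eq0 (n + n)) => k le_k.
by rewrite tele_to_add // tele_to_opp /tele_to rmorphB.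
Qed.

Lemma tele_in_monoid n : monoid_morphism (tele_in n).
Proof.
split=> [|a b].
  by apply: (@tele_eq0 n) => k _; rewrite !(tele_to_cst _ _ true).
rewrite /tele_in -[RHS]/(tele_mul _ _) !piE.
apply: (@tele_eq0 (n + n)) => k le_k.
by rewrite tele_to_mul // /tele_to rmorphM.
Qed.

HB.instance Definition _ n :=
  GRing.isZmodMorphism.Build R tele_lim (tele_in n) (tele_in_zmod n).
HB.instance Definition _ n :=
  GRing.isMonoidMorphism.Build R tele_lim (tele_in n) (tele_in_monoid n).

Lemma tele_inS n a : tele_in n.+1 (phi a) = tele_in n a.
Proof.
apply: (@tele_eq0 n.+1) => k lt_nk.
by rewrite /tele_to /= -iterSr subnSK.
Qed.

Lemma tele_in_surj z : exists n a, z = tele_in n a.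
Proof. by elim/quotW: z => -[n a]; exists n, a. Qed.

Lemma tele_in_eq0 n a : tele_in n a = 0 <-> exists k, iter k phi a = 0.
Proof.
have in0 k : tele_in k 0 = 0 by rewrite rmorph0.
split=> [|[k a0]].
  rewrite -(in0 n) => /eqP/tele_eqP[k0 /(_ _ (leq_addr n k0))].
  by rewrite /tele_to /= addnK rmorph0 => a0; exists k0.
suff <- : tele_in (k + n) (iter k phi a) = tele_in n a by rewrite a0 in0.
by elim: k {a0} => //= k IHk; rewrite addSn tele_inS.
Qed.

End TelescopeLimit.

Definition perfect_closure (R : comNzRingType) (p : nat)
    (chR : p \in [pchar R]) : comNzRingType :=
  tele_lim (pFrobenius_aut chR).

(* The tensor product over a commutative ring: formal finite sums of pairs
   (m, n), two sums being identified when every bilinear map out of M * N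
   takes the same value on both.  By tens_liftE and tens_gen, tens_pure is a
   universal bilinear map, which determines the tensor product. *)
Section Tensor.
Variables (S : comNzRingType) (M N : lmodType S).
Implicit Types u v w : seq (M * N).

Definition tens_eval (G : lmodType S) (b : M -> N -> G) u : G :=
  \sum_(x <- u) b x.1 x.2.

Definition tens_rel u v : bool :=
  `[< forall (G : lmodType S) (b : {bilinear M -> N -> G}),
        tens_eval b u = tens_eval b v >].

Lemma tens_rel_equiv : equiv_class_of tens_rel.
Proof.
split=> [u|u v|v u w]; first exact/asboolP.
  by apply/asboolP/asboolP => e G b; rewrite e.
by move=> /asboolP e1 /asboolP e2; apply/asboolP => G b; rewrite e1.
Qed.

Canonical tens_equiv := EquivRelPack tens_rel_equiv.

Definition tens := {eq_quot tens_rel}.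
HB.instance Definition _ : EqQuotient _ tens_rel tens := EqQuotient.on tens.
HB.instance Definition _ := Choice.on tens.

Lemma tens_eqP u v :
  (forall (G : lmodType S) (b : {bilinear M -> N -> G}),
     tens_eval b u = tens_eval b v) <-> \pi_tens u = \pi_tens v.
Proof.
split=> [e|/eqP]; first by apply/eqP; rewrite eqmodE; apply/asboolP.
by rewrite eqmodE => /asboolP.
Qed.

Lemma tens_eval_repr (G : lmodType S) (b : {bilinear M -> N -> G}) u :
  tens_eval b (repr (\pi_tens u)) = tens_eval b u.
Proof. by move: G b; apply/tens_eqP; rewrite reprK. Qed.

Definition tens_scalep (a : S) u := [seq (a *: x.1, x.2) | x <- u].

Lemma tens_eval_cat (G : lmodType S) (b : M -> N -> G) u v :
  tens_eval b (u ++ v) = tens_eval b u + tens_eval b v.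
Proof. exact: big_cat. Qed.

Lemma tens_eval_scale (G : lmodType S) (b : {bilinear M -> N -> G}) a u :
  tens_eval b (tens_scalep a u) = a *: tens_eval b u.
Proof.
rewrite /tens_eval big_map scaler_sumr; apply: eq_bigr => x _ /=.
by rewrite linearZl_LR.
Qed.

Lemma tens_eval_nil (G : lmodType S) (b : M -> N -> G) :
  tens_eval b [::] = 0.
Proof. exact: big_nil. Qed.

Definition tens_zero : tens := \pi_tens [::].
Definition tens_add (x y : tens) : tens := \pi_tens (repr x ++ repr y).
Definition tens_scale (a : S) (x : tens) : tens := \pi_tens (tens_scalep a (repr x)).
Definition tens_opp := tens_scale (-1).

Let tensE := (tens_eval_repr, tens_eval_cat, tens_eval_scale, tens_eval_nil).

Lemma tens_addA : associative tens_add.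
Proof. by move=> x y z; apply/tens_eqP => G b; rewrite !tensE addrA. Qed.

Lemma tens_addC : commutative tens_add.
Proof. by move=> x y; apply/tens_eqP => G b; rewrite !tensE addrC. Qed.

Lemma tens_add0 : left_id tens_zero tens_add.
Proof.
elim/quotW=> u; apply/tens_eqP => G b.
by rewrite !tensE add0r.
Qed.

Lemma tens_addN : left_inverse tens_zero tens_opp tens_add.
Proof. by move=> x; apply/tens_eqP => G b; rewrite !tensE scaleN1r addNr. Qed.

HB.instance Definition _ :=
  GRing.isZmodule.Build tens tens_addA tens_addC tens_add0 tens_addN.

Lemma tens_scaleA a b (x : tens) :
  tens_scale a (tens_scale b x) = tens_scale (a * b) x.
Proof. by apply/tens_eqP => G c; rewrite !tensE scalerA. Qed.

Lemma tens_scale1 : left_id 1 tens_scale.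
Proof. by elim/quotW=> u; apply/tens_eqP => G b; rewrite !tensE scale1r. Qed.

Lemma tens_scaleDr : right_distributive tens_scale +%R.
Proof. by move=> a x y; apply/tens_eqP => G b; rewrite !tensE scalerDr. Qed.

Lemma tens_scaleDl x : {morph tens_scale^~ x : a b / a + b}.
Proof. by move=> a b; apply/tens_eqP => G c; rewrite !tensE scalerDl. Qed.

HB.instance Definition _ := GRing.Zmodule_isLmodule.Build S tens
  tens_scaleA tens_scale1 tens_scaleDr tens_scaleDl.

Definition tens_pure (m : M) (n : N) : tens := \pi_tens [:: (m, n)].

Lemma tens_eval1 (G : lmodType S) (b : M -> N -> G) m n :
  tens_eval b [:: (m, n)] = b m n.
Proof. exact: big_seq1. Qed.

Lemma tens_pure_bilinear : bilinear_for *:%R *:%R tens_pure.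
Proof.
split=> [n a m m'|m a n n']; apply/tens_eqP => G b;
  rewrite !tensE !tens_eval1; first by rewrite linearPl.
by rewrite linearPr.
Qed.

HB.instance Definition _ := bilinear_isBilinear.Build S M N tens
  *:%R *:%R tens_pure tens_pure_bilinear.

Section Lift.
Variables (G : lmodType S) (b : {bilinear M -> N -> G}).

Definition tens_lift (x : tens) : G := tens_eval b (repr x).

Lemma tens_lift_linear : linear tens_lift.
Proof. by move=> a x y; rewrite /tens_lift !tensE. Qed.

HB.instance Definition _ :=
  GRing.isLinear.Build S tens G _ tens_lift tens_lift_linear.

Lemma tens_liftE m n : tens_lift (tens_pure m n) = b m n.
Proof. by rewrite /tens_lift tens_eval_repr tens_eval1. Qed.

End Lift.

Lemma tens_gen (x : tens) :
  exists u, x = \sum_(p <- u) tens_pure p.1 p.2.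
Proof.
elim/quotW: x => u; exists u; elim: u => [|[m n] u IHu].
  by rewrite big_nil.
rewrite big_cons -IHu; apply/tens_eqP => G b.
by rewrite !tensE -cat1s tens_eval_cat.
Qed.

End Tensor.

Section TensorMap.
Variables (S : comNzRingType) (M N N' : lmodType S) (f : {linear N -> N'}).

Definition tens_pure_comp (m : M) (n : N) : tens M N' := tens_pure m (f n).

Lemma tens_pure_comp_bilinear : bilinear_for *:%R *:%R tens_pure_comp.
Proof.
by split=> [n a m m'|m a n n']; rewrite /tens_pure_comp;
  [rewrite linearPl | rewrite linearP linearPr].
Qed.

HB.instance Definition _ := bilinear_isBilinear.Build S M N (tens M N')
  *:%R *:%R tens_pure_comp tens_pure_comp_bilinear.

Definition tens_map : {linear tens M N -> tens M N'} :=
  tens_lift tens_pure_comp.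

Lemma tens_mapE m n : tens_map (tens_pure m n) = tens_pure m (f n).
Proof. exact: tens_liftE. Qed.

End TensorMap.

(* Homological dimensions take their values in option nat, None standing for
   infinity. *)
Definition dim_le (d : option nat) (n : nat) : bool :=
  if d is Some m then (m <= n)%N else false.

Definition least (P : nat -> Prop) : option nat :=
  if pselect (exists n, `[< P n >]) is left exP then Some (ex_minn exP)
  else None.

Lemma least_SomeP (P : nat -> Prop) n :
  least P = Some n <-> P n /\ forall m, P m -> (n <= m)%N.
Proof.
rewrite /least; case: pselect => [exP|nexP]; last first.
  by split=> // -[Pn _]; case: nexP; exists n; apply/asboolP.
case: ex_minnP => k /asboolP Pk mink; split=> [[<-]|[Pn minn]].
  by split=> // m /asboolP/mink.
by congr Some; apply/eqP; rewrite eqn_leq minn // mink //; apply/asboolP.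
Qed.

Section HomologicalDimension.
Variable S : comNzRingType.

Definition projective_module (P : lmodType S) : Prop :=
  forall (A B : lmodType S) (g : {linear A -> B}) (h : {linear P -> B}),
    (forall y, exists x, g x = y) ->
    exists k : {linear P -> A}, forall x, g (k x) = h x.

Definition flat_module (M : lmodType S) : Prop :=
  forall (N N' : lmodType S) (f : {linear N -> N'}),
    injective f -> injective (tens_map M f).

(* There is an exact sequence
   0 -> P_n -> ... -> P_1 -> P_0 -> M -> 0 with all P_i in the class C. *)
Definition has_resolution (C : lmodType S -> Prop) (M : lmodType S)
    (n : nat) : Prop :=
  exists (P : nat -> lmodType S) (d : forall i, {linear P i.+1 -> P i})
         (eps : {linear P 0%N -> M}),
    [/\ forall i, C (P i),
        forall i, (n < i)%N -> forall x : P i, x = 0,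
        forall y, exists x, eps x = y,
        forall x, eps x = 0 <-> exists y, d 0%N y = x
      & forall i x, d i x = 0 <-> exists y, d i.+1 y = x].

Definition proj_dim (M : lmodType S) : option nat :=
  least (has_resolution projective_module M).

Definition flat_dim (M : lmodType S) : option nat :=
  least (has_resolution flat_module M).

(* Suprema over all modules, i.e. least upper bounds. *)
Definition gl_dim : option nat :=
  least (fun n => forall M : lmodType S, dim_le (proj_dim M) n).

Definition w_dim : option nat :=
  least (fun n => forall M : lmodType S, dim_le (flat_dim M) n).

End HomologicalDimension.

Section F2t.
Variables (L : fieldType) (iota : {rmorphism {fraction {poly 'F_2}} -> L}).

Definition F2t_cst : {rmorphism 'F_2 -> L} :=
  iota \o (@FracField.tofrac {poly 'F_2}) \o polyC.

Definition F2t_var : L := iota (FracField.tofrac 'X).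

End F2t.

Lemma pchar_F2 : 2%N \in [pchar 'F_2].
Proof. exact: pchar_Fp. Qed.

(* Main.v *)
Require Import Defs.
From HB Require Import structures.
From mathcomp Require Import all_boot all_order all_algebra.
From mathcomp Require Import fraction mxpoly.
From mathcomp Require Import sesquilinear generic_quotient ring_quotient.
From mathcomp Require Import boolp functions wochoice.

Set Implicit Arguments.
Unset Strict Implicit.
Unset Printing Implicit Defensive.

Import GRing.Theory.
Local Open Scope ring_scope.

(** Why the theorem holds.

    Since (t s)^2 = t^2 (t + 1), the Frobenius map sends R = F_2[t, t s] into
    F_2[t]. So R and F_2[t] have the same perfect closure, which is the union
    of the principal ideal domains F_2[t^(1/2^n)]: a countable Bezout domain A
    that is not a field. Every ideal of A is generated by a sequence (a n) in
    which each term divides the preceding one, a n = b n * a n.+1, and so it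
    is the limit of a telescope (telescopic_of_countable_bezout).

    Upper bounds. Let M be a module and K the kernel of the free cover of M by
    F = A^(M). Well-order M and look at leading coefficients: for every index
    i they form an ideal, with generators a i n and relations
    a i n = b i n * a i n.+1. Lifting these to K gives an exact sequence
    0 -> A^(Y) -> A^(Y) -> K -> 0 with Y = M x nat, where the relations form a
    unitriangular matrix (submodule_presentation). This is a projective
    resolution of M of length 2. A unitriangular matrix remains injective over
    every coefficient module, so Tor_1(K, -) = 0; this makes K flat
    (flat_of_presentation), and 0 -> K -> F -> M -> 0 is a flat resolution.

    Lower bounds. The module A / tA is killed by t, so it is not flat, and the
    weak dimension is not 0. Let I be the ideal generated by all roots of t of
    order 2^n. If A / I had a projective resolution of length 1, then I would
    be projective and the telescope would split; but a section of it takes its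
    values in finitely many coordinates, which would make I principal
    (chain_cover_not_split). *)

(** * Submodules, quotients and linear maps *)

Section LinearMaps.
Variables (A : pzRingType) (U V : lmodType A).

(** Sealed: a transparent bundled map lets simplification and unification
    unfold everything that is later defined as a linear map on a direct
    sum. *)
Lemma mklinear_sig (f : U -> V) : linear f -> {g : {linear U -> V} | g =1 f}.
Proof.
move=> f_lin.
pose g : {linear U -> V} := HB.pack f (GRing.isLinear.Build A U V _ f f_lin).
by exists g.
Qed.

Definition mklinear (f : U -> V) (f_lin : linear f) : {linear U -> V} :=
  sval (mklinear_sig f_lin).

Lemma mklinearE (f : U -> V) (f_lin : linear f) x : mklinear f_lin x = f x.
Proof. exact: (svalP (mklinear_sig f_lin)). Qed.

End LinearMaps.

Section Submodule.
Variables (A : pzRingType) (V : lmodType A).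

Record submodule := Submodule {
  in_submod :> V -> Prop;
  submod0 : in_submod 0;
  submodP : forall c x y,
    in_submod x -> in_submod y -> in_submod (c *: x + y) }.

Variable W : submodule.

Lemma submodD x y : W x -> W y -> W (x + y).
Proof. by move=> Wx Wy; rewrite -[x]scale1r; apply: submodP. Qed.

Lemma submodZ c x : W x -> W (c *: x).
Proof. by move=> Wx; rewrite -[_ *: _]addr0; apply/submodP/submod0. Qed.

Lemma submodB x y : W x -> W y -> W (x - y).
Proof. by move=> Wx Wy; rewrite addrC -scaleN1r; apply: submodP. Qed.

Lemma submod_sum (I : eqType) (s : seq I) (F : I -> V) :
  (forall i, i \in s -> W (F i)) -> W (\sum_(i <- s) F i).
Proof.
move=> WF; rewrite big_seq; elim/big_ind: _ => //; first exact: submod0.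
exact: submodD.
Qed.

Definition submod_pred : {pred V} := fun x => `[< W x >].

Lemma submod_predP : submod_closed submod_pred.
Proof.
split=> [|c x y /asboolP Wx /asboolP Wy]; apply/asboolP; first exact: submod0.
exact: submodP.
Qed.

HB.instance Definition _ := GRing.isSubmodClosed.Build A V submod_pred
  (GRing.submod_closed_semi submod_predP).

Record submod_type := SubmodElt {
  submod_val : V;
  submod_valP : submod_val \in submod_pred }.

HB.instance Definition _ := [isSub for submod_val].
HB.instance Definition _ := [Choice of submod_type by <:].
HB.instance Definition _ := [SubChoice_isSubLmodule of submod_type by <:].

Lemma submod_val_in (x : submod_type) : W (submod_val x).
Proof. exact/asboolP/submod_valP. Qed.

Definition submod_mk x (Wx : W x) : submod_type :=
  SubmodElt (introT (asboolP (W x)) Wx).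

Lemma submod_val_linear : linear submod_val.
Proof. by []. Qed.

HB.instance Definition _ := GRing.isLinear.Build A submod_type V _
  submod_val submod_val_linear.

Local Open Scope quotient_scope.

Definition quot_mod := @Quotient.quot V submod_pred.
HB.instance Definition _ := ZmodQuotient.on quot_mod.

Definition quot_pi (x : V) : quot_mod := \pi_(quot_mod) x.

Lemma quot_piP x y : quot_pi x = quot_pi y <-> W (x - y).
Proof.
have eqE := Quotient.idealrBE submod_pred x y.
split=> [/eqP|Wxy]; last by apply/eqP; rewrite -[_ == _]eqE; apply/asboolP.
by rewrite -[_ == _]eqE => /asboolP.
Qed.

Lemma quot_repr x : W (repr (quot_pi x) - x).
Proof. by apply/quot_piP; rewrite /quot_pi reprK. Qed.

Definition quot_scale (c : A) (x : quot_mod) : quot_mod :=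
  quot_pi (c *: repr x).

Lemma quot_scaleE c x : quot_scale c (quot_pi x) = quot_pi (c *: x).
Proof. by apply/quot_piP; rewrite -scalerBr; apply/submodZ/quot_repr. Qed.

Lemma quot_surj (x : quot_mod) : exists y, x = quot_pi y.
Proof. by exists (repr x); rewrite /quot_pi reprK. Qed.

Lemma quot_piB : {morph quot_pi : x y / x - y}.
Proof. by move=> x y; rewrite /quot_pi !piE. Qed.
HB.instance Definition _ :=
  GRing.isZmodMorphism.Build V quot_mod quot_pi quot_piB.

Lemma quot_scaleA a b x :
  quot_scale a (quot_scale b x) = quot_scale (a * b) x.
Proof. by have [y ->] := quot_surj x; rewrite !quot_scaleE scalerA. Qed.
Lemma quot_scale1 : left_id 1 quot_scale.
Proof.
by move=> x; have [y ->] := quot_surj x; rewrite !quot_scaleE scale1r.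
Qed.
Lemma quot_scaleDr : right_distributive quot_scale +%R.
Proof.
move=> a x y; have [x' ->] := quot_surj x; have [y' ->] := quot_surj y.
by rewrite -raddfD !quot_scaleE scalerDr raddfD.
Qed.
Lemma quot_scaleDl x : {morph quot_scale^~ x : a b / a + b}.
Proof.
by move=> a b; have [y ->] := quot_surj x; rewrite !quot_scaleE scalerDl raddfD.
Qed.
HB.instance Definition _ := GRing.Zmodule_isLmodule.Build A quot_mod
  quot_scaleA quot_scale1 quot_scaleDr quot_scaleDl.

Lemma quot_pi_scalable : scalable quot_pi.
Proof. by move=> a x; rewrite -quot_scaleE. Qed.
HB.instance Definition _ :=
  GRing.isScalable.Build A V quot_mod _ quot_pi quot_pi_scalable.

Lemma quot_pi0 x : quot_pi x = 0 <-> W x.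
Proof. by rewrite -[0](raddf0 quot_pi) quot_piP subr0. Qed.

End Submodule.

Section LinearSubmodules.
Variables (A : pzRingType) (U V : lmodType A) (f : {linear U -> V}).

Definition ker_submod : submodule U.
Proof.
exists (fun x => f x = 0) => [|c x y fx fy]; first exact: raddf0.
by rewrite linearP fx fy scaler0 addr0.
Defined.

Definition im_submod : submodule V.
Proof.
exists (fun y => exists x, f x = y) => [|c _ _ [x <-] [y <-]].
  by exists 0; rewrite raddf0.
by exists (c *: x + y); rewrite linearP.
Defined.

End LinearSubmodules.

Reserved Notation "q `@ y"
  (at level 12, y at level 9, left associativity, format "q  `@  y").

(** * Direct sums of copies of a module *)

Section DirectSum.
Variables (A : pzRingType) (Y : eqType) (N : lmodType A).

Definition finitely_supported : submodule (Y -> N).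
Proof.
exists (fun f => exists s : seq Y, forall y, y \notin s -> f y = 0).
  by exists [::].
move=> c f g [s fs] [s' gs']; exists (s ++ s') => y.
rewrite mem_cat negb_or => /andP[/fs f0 /gs' g0].
by rewrite addrfctE scalrfctE f0 g0 scaler0 addr0.
Defined.

Definition dsum := submod_type finitely_supported.
HB.instance Definition _ := GRing.Lmodule.on dsum.

Definition dsum_app (q : dsum) : Y -> N := submod_val q.
Arguments dsum_app : simpl never.
Local Notation "q `@ y" := (dsum_app q y).

Lemma dsumP (p q : dsum) : (forall y, p `@ y = q `@ y) -> p = q.
Proof. by move=> pq; apply/val_inj/funext. Qed.

Lemma dsumE c (p q : dsum) y : (c *: p + q) `@ y = c *: p `@ y + q `@ y.
Proof. by []. Qed.

Lemma dsumBE (p q : dsum) y : (p - q) `@ y = p `@ y - q `@ y.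
Proof. by []. Qed.

Lemma dsumZE c (p : dsum) y : (c *: p) `@ y = c *: p `@ y.
Proof. by []. Qed.

Lemma dsum0E y : 0 `@ y = 0.
Proof. by []. Qed.

Lemma dsum_eval_linear y : linear (fun p : dsum => p `@ y).
Proof. by []. Qed.

Definition dsum_mk (f : Y -> N) (s : seq Y)
  (fs : forall y, y \notin s -> f y = 0) : dsum :=
  @submod_mk _ _ finitely_supported f (ex_intro _ s fs).

Lemma supp_ex (q : dsum) : exists s : seq Y, uniq s /\
  forall y, (y \in s) = (q `@ y != 0).
Proof.
have [s qs] := submod_val_in q.
exists (undup [seq y <- s | q `@ y != 0]); split; first exact: undup_uniq.
move=> y; rewrite mem_undup mem_filter andb_idr //.
by apply: contraNT => /qs/eqP.
Qed.

Definition supp (q : dsum) : seq Y := projT1 (cid (supp_ex q)).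

Lemma supp_uniq q : uniq (supp q).
Proof. by rewrite /supp; case: cid => s []. Qed.

Lemma mem_supp q y : (y \in supp q) = (q `@ y != 0).
Proof. by rewrite /supp; case: cid => s []. Qed.

Lemma delta_subproof (y : Y) (n : N) (y' : Y) :
  y' \notin [:: y] -> (if y' == y then n else 0) = 0.
Proof. by rewrite mem_seq1 => /negbTE ->. Qed.

Definition delta y n : dsum := dsum_mk (@delta_subproof y n).
Arguments delta : simpl never.

Lemma deltaE y n y' : (delta y n) `@ y' = if y' == y then n else 0.
Proof. by []. Qed.

Lemma dsum_expand (q : dsum) : q = \sum_(y <- supp q) delta y (q `@ y).
Proof.
apply/dsumP => y; rewrite -[RHS](mklinearE (dsum_eval_linear y)) raddf_sum /=.
under [RHS]eq_bigr do rewrite /= mklinearE.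
have [yq|yNq] := boolP (y \in supp q).
  rewrite (bigD1_seq y) ?supp_uniq //= deltaE eqxx big1 ?addr0 //.
  move=> i /negbTE iy.
  by rewrite deltaE eq_sym iy.
move: (yNq); rewrite mem_supp negbK => /eqP ->; rewrite big_seq big1 // => i.
by rewrite deltaE; case: eqP => // <-; rewrite (negbTE yNq).
Qed.

(** The workhorse for identities between linear constructions: a linear map on
    a direct sum is determined by its values on the vectors with one entry. *)
Lemma dsum_linear_ext (V : lmodType A) (f g : dsum -> V) :
  linear f -> linear g -> (forall y n, f (delta y n) = g (delta y n)) -> f =1 g.
Proof.
move=> f_lin g_lin fg q; rewrite -(mklinearE f_lin) -(mklinearE g_lin).
rewrite (dsum_expand q) !raddf_sum; apply: eq_bigr => y _.
by rewrite /= !mklinearE; apply: fg.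
Qed.

Section Sum.
Variables (V : lmodType A) (g : Y -> {linear N -> V}).

Definition dsum_lift_fun (q : dsum) : V := \sum_(y <- supp q) g y (q `@ y).

Lemma dsum_liftE_seq (q : dsum) s :
  uniq s -> (forall y, y \notin s -> q `@ y = 0) ->
  dsum_lift_fun q = \sum_(y <- s) g y (q `@ y).
Proof.
move=> Us qs; rewrite [RHS](bigID (fun y => q `@ y != 0)) /=.
rewrite [X in _ + X]big1 ?addr0.
  rewrite -[RHS]big_filter; apply: perm_big; apply: uniq_perm.
  - exact: supp_uniq.
  - exact: filter_uniq.
  move=> y; rewrite mem_supp mem_filter andb_idr // => /eqP qy.
  by apply: contra_notT qy => /qs.
by move=> y; rewrite negbK => /eqP ->; rewrite raddf0.
Qed.

Lemma dsum_lift_linear : linear dsum_lift_fun.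
Proof.
move=> c p q; set s := undup (supp p ++ supp q).
have sP r : r \in [:: p; q; c *: p + q] -> forall y, y \notin s -> r `@ y = 0.
  move=> rpq y; rewrite mem_undup mem_cat negb_or !mem_supp !negbK.
  case/andP=> /eqP p0 /eqP q0; move: rpq; rewrite !inE.
  by case/or3P=> /eqP-> //; rewrite dsumE p0 q0 scaler0 addr0.
have sE r : r \in [:: p; q; c *: p + q] ->
    dsum_lift_fun r = \sum_(y <- s) g y (r `@ y).
  by move=> rpq; apply: dsum_liftE_seq (undup_uniq _) (sP r rpq).
rewrite !sE ?inE ?eqxx ?orbT // scaler_sumr -big_split /=.
by apply: eq_bigr => y _; rewrite dsumE linearP.
Qed.

Definition dsum_lift : {linear dsum -> V} := mklinear dsum_lift_linear.

Lemma dsum_liftE q : dsum_lift q = \sum_(y <- supp q) g y (q `@ y).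
Proof. exact: mklinearE. Qed.

Lemma dsum_lift_delta y n : dsum_lift (delta y n) = g y n.
Proof.
rewrite mklinearE (@dsum_liftE_seq _ [:: y]) //.
  by rewrite big_seq1 deltaE eqxx.
exact: delta_subproof.
Qed.

End Sum.
End DirectSum.
Arguments dsum_app : simpl never.
Arguments delta : simpl never.

Notation "q `@ y" := (dsum_app q y).

(** * Matrices acting on direct sums *)

Section Pure.
Variables (A : comNzRingType) (Y : eqType) (N : lmodType A).

Lemma pure_subproof (p : dsum Y A^o) (n : N) y :
  y \notin supp p -> (p `@ y : A) *: n = 0.
Proof. by rewrite mem_supp negbK => /eqP ->; rewrite scale0r. Qed.

(** The image of p (x) n under the isomorphism of A^(Y) (x) N with N^(Y). *)
Definition pure (p : dsum Y A^o) (n : N) : dsum Y N :=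
  dsum_mk (@pure_subproof p n).
Arguments pure : simpl never.

Lemma pureE p n y : (pure p n) `@ y = (p `@ y : A) *: n.
Proof. by []. Qed.

Lemma pure_linearr p : linear (pure p).
Proof.
move=> c m n; apply/dsumP => y.
by rewrite dsumE !pureE scalerDr !scalerA mulrC.
Qed.

Lemma pure_linearl n : linear (pure^~ n).
Proof.
by move=> c p q; apply/dsumP => y; rewrite dsumE !pureE dsumE scalerDl scalerA.
Qed.

Lemma pure_delta y (a : A) n : pure (delta y (a : A^o)) n = delta y (a *: n).
Proof.
by apply/dsumP => y'; rewrite pureE !deltaE; case: ifP => // _; rewrite scale0r.
Qed.

End Pure.
Arguments pure : simpl never.

Section MapDsum.
Variables (A : pzRingType) (Y : eqType).
Variables (N N' : lmodType A) (f : {linear N -> N'}).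

Lemma dsum_map_subproof (q : dsum Y N) y : y \notin supp q -> f (q `@ y) = 0.
Proof. by rewrite mem_supp negbK => /eqP ->; rewrite raddf0. Qed.

Definition dsum_map (q : dsum Y N) : dsum Y N' :=
  dsum_mk (@dsum_map_subproof q).
Arguments dsum_map : simpl never.

Lemma dsum_mapE q y : (dsum_map q) `@ y = f (q `@ y).
Proof. by []. Qed.

Lemma dsum_map_linear : linear dsum_map.
Proof.
by move=> c p q; apply/dsumP => y; rewrite dsumE !dsum_mapE dsumE linearP.
Qed.

Lemma dsum_map_delta y n : dsum_map (delta y n) = delta y (f n).
Proof.
apply/dsumP => y'; rewrite dsum_mapE !deltaE.
by case: ifP => // _; rewrite raddf0.
Qed.

End MapDsum.
Arguments dsum_map : simpl never.

Section Matrix.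
Variables (A : comNzRingType) (Y1 Y0 : eqType) (z : Y1 -> dsum Y0 A^o).

(** The matrix with columns z y, acting on columns with entries in N. It is
    the tensor product with N of the map A^(Y1) -> A^(Y0) given by the same
    matrix. *)
Definition mx_act (N : lmodType A) : {linear dsum Y1 N -> dsum Y0 N} :=
  dsum_lift (fun y => mklinear (@pure_linearr A Y0 N (z y))).

Lemma mx_act_delta (N : lmodType A) y (n : N) :
  mx_act N (delta y n) = pure (z y) n.
Proof. by rewrite /mx_act dsum_lift_delta mklinearE. Qed.

Lemma mx_act_pure (N : lmodType A) r (n : N) :
  mx_act N (pure r n) = pure (mx_act A^o r) n.
Proof.
apply: (@dsum_linear_ext _ _ _ _ (fun r => mx_act N (pure r n))
  (fun r => pure (mx_act A^o r) n)) => [c p q|c p q|y a].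
- by rewrite pure_linearl linearP.
- by rewrite linearP pure_linearl.
rewrite pure_delta !mx_act_delta; apply/dsumP => y'.
by rewrite !pureE scalerA.
Qed.

Lemma mx_act_map (N N' : lmodType A) (f : {linear N -> N'}) q :
  mx_act N' (dsum_map f q) = dsum_map f (mx_act N q).
Proof.
apply: (@dsum_linear_ext _ _ _ _ (fun q => mx_act N' (dsum_map f q))
  (fun q => dsum_map f (mx_act N q))) => [c p p'|c p p'|y n].
- by rewrite dsum_map_linear linearP.
- by rewrite linearP dsum_map_linear.
rewrite dsum_map_delta !mx_act_delta; apply/dsumP => y'.
by rewrite dsum_mapE !pureE linearZ.
Qed.

(** The hypothesis says that the matrix stays injective after tensoring with
    any quotient N / W. *)
Lemma mx_act_injective_of_saturated (N : lmodType A) :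
  (forall (W : submodule N) q,
     (forall y, W ((mx_act N q) `@ y)) -> forall y, W (q `@ y)) ->
  forall q, mx_act N q = 0 -> q = 0.
Proof.
move=> rel q q0; apply/dsumP => y; rewrite dsum0E.
by apply: (rel (ker_submod (idfun : {linear N -> N}))) => y' /=; rewrite q0.
Qed.

End Matrix.

(** * A flatness criterion for presented modules *)

Section Flatness.
Variables (A : comNzRingType) (Y1 Y0 : eqType) (z : Y1 -> dsum Y0 A^o).
Variables (K : lmodType A) (phi : {linear dsum Y0 A^o -> K}).
Hypothesis phi_surj : forall k, exists p, phi p = k.
Hypothesis phi_ker : forall p, phi p = 0 <-> exists q, mx_act z A^o q = p.
Hypothesis saturated : forall (N : lmodType A) (W : submodule N) q,
  (forall y, W ((mx_act z N q) `@ y)) -> forall y, W (q `@ y).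

Lemma tens_pure_linearr (N : lmodType A) (k : K) :
  linear (fun n : N => tens_pure k n).
Proof. by move=> c m n; rewrite linearPr. Qed.

(** Once A^(Y0) (x) N is identified with N^(Y0), this is phi (x) N. *)
Definition to_tens (N : lmodType A) : {linear dsum Y0 N -> tens K N} :=
  dsum_lift (fun y => mklinear (@tens_pure_linearr N (phi (delta y 1)))).

Lemma to_tens_delta (N : lmodType A) y (n : N) :
  to_tens N (delta y n) = tens_pure (phi (delta y 1)) n.
Proof. by rewrite /to_tens dsum_lift_delta mklinearE. Qed.

Lemma to_tens_pure (N : lmodType A) p (n : N) :
  to_tens N (pure p n) = tens_pure (phi p) n.
Proof.
apply: (@dsum_linear_ext _ _ _ _ (fun p => to_tens N (pure p n))
  (fun p => tens_pure (phi p) n)) => [c q q'|c q q'|y a].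
- by rewrite pure_linearl linearP.
- by rewrite linearP linearPl.
rewrite pure_delta to_tens_delta linearZr_LR -linearZl_LR /= -linearZ.
congr (tens_pure (phi _) _); apply/dsumP => y'; rewrite dsumZE !deltaE.
by case: ifP; rewrite ?scaler0 // => _; rewrite -[LHS]/(a * 1) mulr1.
Qed.

Lemma to_tens_surj (N : lmodType A) (x : tens K N) : exists q, to_tens N q = x.
Proof.
have [u ->] := tens_gen x; elim: u => [|[k n] u [q qE]].
  by exists 0; rewrite big_nil raddf0.
have [p pk] := phi_surj k; exists (pure p n + q).
by rewrite big_cons raddfD /= to_tens_pure pk qE.
Qed.

Lemma to_tens_mx (N : lmodType A) q : to_tens N (mx_act z N q) = 0.
Proof.
apply: (@dsum_linear_ext _ _ _ _ (fun q => to_tens N (mx_act z N q))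
  (fun=> 0)) => [c p p'|c p p'|y n].
- by rewrite !linearP.
- by rewrite scaler0 addr0.
rewrite mx_act_delta to_tens_pure.
have -> : phi (z y) = 0.
  apply/phi_ker; exists (delta y 1); rewrite mx_act_delta; apply/dsumP => y'.
  by rewrite pureE -[LHS]/(_ * 1) mulr1.
by rewrite linear0l.
Qed.

Lemma to_tens_map (N N' : lmodType A) (f : {linear N -> N'}) q :
  tens_map K f (to_tens N q) = to_tens N' (dsum_map f q).
Proof.
apply: (@dsum_linear_ext _ _ _ _ (fun q => tens_map K f (to_tens N q))
  (fun q => to_tens N' (dsum_map f q))) => [c p p'|c p p'|y n].
- by rewrite !linearP.
- by rewrite dsum_map_linear linearP.
by rewrite dsum_map_delta !to_tens_delta tens_mapE.
Qed.

Section Kernel.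
Variable N : lmodType A.

Definition phi_inv (k : K) : dsum Y0 A^o := projT1 (cid (phi_surj k)).

Lemma phi_invK k : phi (phi_inv k) = k.
Proof. by rewrite /phi_inv; case: cid. Qed.

Definition cok := quot_mod (im_submod (mx_act z N)).

Lemma cok_pure p p' (n : N) : phi p = phi p' ->
  quot_pi (im_submod (mx_act z N)) (pure p n) = quot_pi _ (pure p' n).
Proof.
move=> pp'; apply/quot_piP.
have [q qE] : exists q, mx_act z A^o q = p - p'.
  by apply/phi_ker; rewrite raddfB /= pp' subrr.
exists (pure q n); rewrite mx_act_pure qE; apply/dsumP => y.
by rewrite dsumBE !pureE dsumBE scalerBl.
Qed.

(** The cokernel of the matrix on N^(Y1) receives this bilinear map because a
    change of the chosen preimage under phi moves the value within the
    image. *)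
Definition cok_pairing (k : K) (n : N) : cok := quot_pi _ (pure (phi_inv k) n).

Lemma cok_pairing_bilinear : bilinear_for *:%R *:%R cok_pairing.
Proof.
split=> [n c k k'|k c n n']; last by rewrite /cok_pairing pure_linearr linearP.
rewrite /cok_pairing -linearP -(pure_linearl n); apply: cok_pure.
by rewrite linearP /= !phi_invK.
Qed.

HB.instance Definition _ := bilinear_isBilinear.Build A K N cok
  *:%R *:%R cok_pairing cok_pairing_bilinear.

(** Right exactness of the tensor product: the map induced by cok_pairing on
    K (x) N sends the class of q back to the class of q in the cokernel. *)
Lemma to_tens_ker q : to_tens N q = 0 -> exists r, mx_act z N r = q.
Proof.
suff e : tens_lift cok_pairing (to_tens N q) =
    quot_pi (im_submod (mx_act z N)) q.
  by move=> q0; apply/(quot_pi0 (im_submod (mx_act z N))); rewrite -e q0 raddf0.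
apply: (@dsum_linear_ext _ _ _ _
  (fun q => tens_lift cok_pairing (to_tens N q))
  (quot_pi (im_submod (mx_act z N)))) => [c p p'|c p p'|y n].
- by rewrite !linearP.
- by rewrite linearP.
rewrite to_tens_delta tens_liftE /= /cok_pairing.
by rewrite (@cok_pure _ (delta y 1)) ?phi_invK // pure_delta scale1r.
Qed.

End Kernel.

(** If K is the cokernel of the matrix z, then K (x) N is the cokernel of z
    acting on N^(Y1). When q in N^(Y0) dies in K (x) N', its image is z r' for
    some r' over N'; the saturation hypothesis, applied to the image of N in
    N', forces r' to have entries in N, so q is already zero in K (x) N. The
    hypothesis is a form of Tor_1(K, N' / N) = 0. *)
Lemma flat_of_presentation : flat_module K.
Proof.
move=> N N' f f_inj x1 x2 ex; apply/eqP; rewrite -subr_eq0; apply/eqP.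
have : tens_map K f (x1 - x2) = 0 by rewrite raddfB /= ex subrr.
move: (x1 - x2) => x {x1 x2 ex}; have [q <-] := to_tens_surj x.
rewrite to_tens_map => /to_tens_ker[r' r'E].
have r'f y : exists n, f n = r' `@ y.
  apply: (saturated (W := im_submod f)) => y0; rewrite r'E dsum_mapE.
  by exists (q `@ y0).
pose r_fun y := projT1 (cid (r'f y)).
have r_funE y : f (r_fun y) = r' `@ y by rewrite /r_fun; case: cid.
have r_supp y : y \notin supp r' -> r_fun y = 0.
  rewrite mem_supp negbK => /eqP r0; apply: f_inj.
  by rewrite r_funE r0 raddf0.
pose r : dsum Y1 N := dsum_mk r_supp.
have rE : dsum_map f r = r' by apply/dsumP => y; rewrite dsum_mapE -r_funE.
suff <- : mx_act z N r = q by rewrite to_tens_mx.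
apply/dsumP => y; apply: f_inj; rewrite -!(dsum_mapE f).
by rewrite -mx_act_map rE r'E.
Qed.

End Flatness.

(** * Free modules and resolutions *)

Section Free.
Variable A : comNzRingType.

Lemma dsum_projective (Y : eqType) : projective_module (dsum Y A^o).
Proof.
move=> B C g h g_surj.
pose pre y := projT1 (cid (g_surj (h (delta y 1)))).
have preE y : g (pre y) = h (delta y 1) by rewrite /pre; case: cid.
have lin y : linear (fun a : A^o => (a : A) *: pre y).
  by move=> c a b; rewrite scalerDl scalerA.
exists (dsum_lift (fun y => mklinear (lin y))).
apply: dsum_linear_ext => [c p q|c p q|y a]; try by rewrite !linearP.
rewrite dsum_lift_delta mklinearE linearZ /= preE -linearZ.
congr (h _); apply/dsumP => y'; rewrite dsumZE !deltaE.
by case: ifP; rewrite ?scaler0 // => _; rewrite -[LHS]/(a * 1) mulr1.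
Qed.

Lemma dsum_flat (Y : eqType) : flat_module (dsum Y A^o).
Proof.
pose z (v : void) : dsum Y A^o := match v with end.
have mx0 (N : lmodType A) q : mx_act z N q = 0.
  by rewrite /mx_act dsum_liftE; case: (supp q) => [|[]]; rewrite big_nil.
apply: (@flat_of_presentation _ void Y z _ idfun).
- by move=> k; exists k.
- move=> p; split=> [/= ->|[q <-]]; last by rewrite mx0.
  by exists 0; rewrite raddf0.
- by move=> N W q _ [].
Qed.

Definition zero_mod : lmodType A := dsum void A^o.

Lemma zero_modP (x : zero_mod) : x = 0.
Proof. by apply/dsumP => -[]. Qed.

End Free.

Section Dimensions.

Lemma least_spec (P : nat -> Prop) n :
  P n -> (forall m, P m -> (n <= m)%N) -> least P = Some n.
Proof. by move=> Pn nP; apply/least_SomeP. Qed.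

Lemma dim_le_least (P : nat -> Prop) n :
  (forall i j, (i <= j)%N -> P i -> P j) -> dim_le (least P) n <-> P n.
Proof.
move=> Pmono; split.
  case e : (least P) => [m|] //= mn; apply: Pmono mn _.
  by case/least_SomeP: e.
move=> Pn; rewrite /least; case: pselect => [ex|[]]; last first.
  by exists n; apply/asboolP.
by rewrite /dim_le; case: ex_minnP => m _; apply; apply/asboolP.
Qed.

Variable A : comNzRingType.

Lemma has_resolution_mono (C : lmodType A -> Prop) M i j :
  (i <= j)%N -> has_resolution C M i -> has_resolution C M j.
Proof.
move=> ij [P [d [eps [CP P0 surj e0 e1]]]]; exists P, d, eps; split=> // k jk.
exact/P0/(leq_ltn_trans ij).
Qed.

Lemma dim_le_resolution (C : lmodType A -> Prop) M n :
  dim_le (least (has_resolution C M)) n <-> has_resolution C M n.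
Proof. by apply: dim_le_least => i j; apply: has_resolution_mono. Qed.

(** A family indexed by nat, since this is the shape in which resolutions are
    given; the terms after the third vanish. *)
Definition three_terms (P0 P1 P2 : lmodType A) (i : nat) : lmodType A :=
  match i with 0 => P0 | 1 => P1 | 2 => P2 | _ => zero_mod A end.

Lemma zero_linear_subproof (U V : lmodType A) : linear (fun _ : U => 0 : V).
Proof. by move=> c u v; rewrite scaler0 addr0. Qed.

Definition zero_linear (U V : lmodType A) : {linear U -> V} :=
  mklinear (@zero_linear_subproof U V).

Definition three_maps (P0 P1 P2 : lmodType A)
    (d0 : {linear P1 -> P0}) (d1 : {linear P2 -> P1}) (i : nat) :
    {linear three_terms P0 P1 P2 i.+1 -> three_terms P0 P1 P2 i} :=
  match i with 0 => d0 | 1 => d1 | _ => zero_linear _ _ end.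

(** Covers lengths one and two at once: for length one the third term is
    required to vanish. *)
Lemma resolution_of_three_terms (C : lmodType A -> Prop)
    (M P0 P1 P2 : lmodType A) (eps : {linear P0 -> M})
    (d0 : {linear P1 -> P0}) (d1 : {linear P2 -> P1}) n :
  (1 <= n)%N -> ((n < 2)%N -> forall x : P2, x = 0) ->
  C P0 -> C P1 -> C P2 -> C (zero_mod A) ->
  (forall y, exists x, eps x = y) ->
  (forall x, eps x = 0 <-> exists y, d0 y = x) ->
  (forall x, d0 x = 0 <-> exists y, d1 y = x) ->
  (forall x, d1 x = 0 -> x = 0) -> has_resolution C M n.
Proof.
move=> n1 n2 C0 C1 C2 Cz surj e0 e1 e2.
exists (three_terms P0 P1 P2), (three_maps d0 d1), eps; split=> //.
- by case=> [|[|[|i]]].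
- case=> [|[|[|i]]] //= n_lt; last by move=> x; apply: zero_modP.
    by move: (leq_trans n_lt n1); rewrite ltnn.
- case=> [|[|i]] x //=.
    split=> [/e2 ->|[y <-]]; first by exists 0; rewrite raddf0.
    by rewrite (zero_modP y) !raddf0.
  by rewrite (zero_modP x) raddf0; split=> // _; exists 0; rewrite raddf0.
Qed.

End Dimensions.

(** * Supports in well-ordered index sets *)

Section WellOrder.
Variables (X : eqType) (R : rel X) (Rwo : well_order R).

Let Rchain : wo_chain R predT.
Proof. by move/withinW: Rwo; apply. Qed.

Lemma wo_total : total R.
Proof. by move=> x y; apply: (wo_chainW Rchain). Qed.

Lemma wo_refl : reflexive R.
Proof. by move=> x; apply: (wo_chain_reflexive Rchain). Qed.

Lemma wo_anti : antisymmetric R.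
Proof. by move=> x y; apply: (wo_chain_antisymmetric Rchain). Qed.

Lemma wo_trans : transitive R.
Proof.
move=> y x z xy yz; have [|w [[]]] := Rwo (A := mem [:: x; y; z]).
  by exists x; rewrite inE eqxx.
have [xin yin zin] : [/\ x \in mem [:: x; y; z], y \in mem [:: x; y; z]
    & z \in mem [:: x; y; z]] by rewrite !inE !eqxx !orbT.
move=> win wR _; move: win; rewrite !inE => /or3P[] /eqP wE; subst w.
- exact: wR.
- by have -> : x = y by apply: wo_anti; rewrite xy wR.
- by have <- : y = z by apply: wo_anti; rewrite yz wR.
Qed.

(** Well-founded induction, with j strictly below i expressed as ~~ R i j. *)
Lemma wo_ind (P : X -> Prop) :
  (forall i, (forall j, ~~ R i j -> P j) -> P i) -> forall i, P i.
Proof.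
move=> Pind i; apply: contrapT => NPi.
have [|m [[/asboolP NPm mR] _]] := Rwo (A := fun x => `[< ~ P x >]).
  by exists i; apply/asboolP.
apply: NPm; apply: Pind => j; apply: contraNP => NPj.
by apply: mR; apply/asboolP.
Qed.

Lemma wo_max (s : seq X) : s <> [::] ->
  exists2 x, x \in s & forall y, y \in s -> R y x.
Proof.
elim: s => // x [_ _|y s IHs _].
  by exists x; rewrite ?inE // => y; rewrite inE => /eqP ->; apply: wo_refl.
have [//|m min mR] := IHs; have [xm|mx] := orP (wo_total x m).
  exists m; first by rewrite inE min orbT.
  by move=> w; rewrite inE => /predU1P[->|/mR].
exists x; first by rewrite inE eqxx.
move=> w; rewrite inE => /predU1P[->|/mR wm]; first exact: wo_refl.
exact: wo_trans mx.
Qed.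

End WellOrder.

Section Supported.
Variables (A : pzRingType) (Y : eqType) (N : lmodType A).

Definition supported (P : pred Y) : submodule (dsum Y N).
Proof.
exists (fun p => forall y, ~~ P y -> p `@ y = 0) => // c p q pP qP y Py.
by rewrite dsumE pP // qP // scaler0 addr0.
Defined.

Lemma supportedW (P Q : pred Y) p : (forall y, P y -> Q y) ->
  supported P p -> supported Q p.
Proof. by move=> PQ pP y Qy; apply: pP; apply: contra Qy; apply: PQ. Qed.

Lemma supported_delta (P : pred Y) y n : P y -> supported P (delta y n).
Proof.
by move=> Py y' Py'; rewrite deltaE; case: eqP => // yy'; rewrite yy' Py in Py'.
Qed.

Lemma mem_supported (P : pred Y) p y : supported P p -> y \in supp p -> P y.
Proof. by move=> pP; rewrite mem_supp; apply: contraNT => /pP ->. Qed.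

Variables (X : eqType) (R : rel X) (Rwo : well_order R) (key : Y -> X).

(** The leading position of a nonzero vector, for the order of the keys.
    Several positions may share the top key. *)
Lemma dsum_top (p : dsum Y N) : p = 0 \/
  exists2 y, y \in supp p & supported (fun y' => R (key y') (key y)) p.
Proof.
have [s0|s0] := eqVneq [seq key y | y <- supp p] [::].
  left; apply/dsumP => y; rewrite dsum0E; apply/eqP.
  rewrite -[_ == _]negbK -mem_supp.
  by move: s0; case: (supp p).
have [x /mapP[y yp ->] xR] := wo_max Rwo (elimN eqP s0).
right; exists y => // y'; apply: contraNeq; rewrite -mem_supp => y'p.
exact/xR/map_f.
Qed.

End Supported.

Lemma wo_lt_le (X : eqType) (R : rel X) (Rwo : well_order R) i j :
  ~~ R i j -> R j i.
Proof. by have := wo_total Rwo i j; case: (R i j). Qed.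

Lemma wo_lt_trans (X : eqType) (R : rel X) (Rwo : well_order R) i j k :
  R k j -> ~~ R i j -> ~~ R i k.
Proof. by move=> kj; apply: contra => ik; apply: (wo_trans Rwo) ik kj. Qed.

(** * Submodules of free modules *)

Section LeadingTerms.
Variables (A : comNzRingType) (X : eqType) (R : rel X) (Rwo : well_order R).
Variable K : submodule (dsum X A^o).
Variables (a b : X -> nat -> A) (k : X -> nat -> submod_type K).

Local Notation le i := (fun j => R j i).
Local Notation lt i := (fun j => ~~ R i j).
Local Notation Y := (X * nat)%type.
Local Notation leY i := (fun y : Y => R y.1 i).
Local Notation ltY i := (fun y : Y => ~~ R i y.1).
Local Notation kval := (@submod_val A (dsum X A^o) K).

Hypothesis k_le : forall i n, supported A^o (le i) (kval (k i n)).
Hypothesis k_lead : forall i n, kval (k i n) `@ i = a i n.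
Hypothesis a_gen : forall i f, K f -> supported A^o (le i) f ->
  exists n r, f `@ i = r * a i n.
Hypothesis a_chain : forall i n, a i n = b i n * a i n.+1.
Hypothesis a_reg : forall i n c, c * a i n = 0 -> c * b i n = 0.

Lemma scale_const_linear (V : lmodType A) (v : V) :
  linear (fun c : A^o => (c : A) *: v).
Proof. by move=> c d e; rewrite scalerDl scalerA. Qed.

Definition gen_map : {linear dsum Y A^o -> submod_type K} :=
  dsum_lift (fun y => mklinear (scale_const_linear (k y.1 y.2))).
Local Notation phi := gen_map.

Lemma genB p q : phi (p - q) = phi p - phi q.
Proof. exact: raddfB. Qed.

Lemma genZ c p : phi (c *: p) = c *: phi p.
Proof. exact: linearZ. Qed.

Lemma gen_delta i n c : phi (delta (i, n) c) = (c : A) *: k i n.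
Proof. by rewrite /gen_map dsum_lift_delta mklinearE. Qed.

Lemma val_eval_linear i : linear (fun f : submod_type K => kval f `@ i).
Proof. by move=> c f g; rewrite linearP. Qed.

Definition val_eval (i : X) : {linear submod_type K -> A^o} :=
  mklinear (val_eval_linear i).

Lemma gen_lt i p : supported A^o (ltY i) p -> kval (phi p) `@ i = 0.
Proof.
move=> p_lt; suff: ker_submod (val_eval i) (phi p) by rewrite /= mklinearE.
rewrite /gen_map dsum_liftE; apply: submod_sum => -[j n] yp.
rewrite /= !mklinearE linearZ dsumZE k_le ?scaler0 //.
exact: (mem_supported p_lt yp).
Qed.

Lemma supported_lt_of_le i f : supported A^o (le i) f -> f `@ i = 0 ->
  supported A^o (lt i) f.
Proof.
move=> f_le fi j; rewrite negbK => ij; have [ji|] := boolP (R j i);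
  last exact: f_le.
by have <- : i = j by apply: (wo_anti Rwo); rewrite ij.
Qed.

(** Gaussian elimination from the top: subtracting a multiple of a generator k
    i n kills the entry at i, and the remainder has a strictly smaller leading
    index. *)
Lemma gen_surj_le i (f : submod_type K) : supported A^o (le i) (kval f) ->
  exists2 p, supported A^o (leY i) p & phi p = f.
Proof.
elim/(wo_ind Rwo): i f => i IHi f f_le.
have [n [r fi]] := a_gen (submod_val_in f) f_le.
pose f' := f - r *: k i n.
have f'E : kval f' = kval f - r *: kval (k i n) by rewrite raddfB linearZ.
have f'_lt : supported A^o (lt i) (kval f').
  rewrite f'E; apply: supported_lt_of_le; first exact/submodB/submodZ.
  by rewrite dsumBE dsumZE k_lead fi -[_ *: _]/(_ * _) subrr.
suff [p p_le pf'] : exists2 p, supported A^o (leY i) p & phi p = f'.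
  exists (p + r *: delta (i, n) 1).
    apply/submodD/submodZ => //; apply: supported_delta; exact: wo_refl.
  by rewrite raddfD /= linearZ /= gen_delta scale1r pf' addrNK.
have [f'0|[j jf' f'_le]] := dsum_top Rwo id (kval f').
  exists 0; first exact: submod0.
  by rewrite raddf0; apply: val_inj.
have ij := mem_supported f'_lt jf'.
have [p p_le pf'] := IHi j ij f' f'_le; exists p => //.
by apply: supportedW p_le => y yj; apply/(wo_lt_le Rwo)/(wo_lt_trans Rwo yj).
Qed.

Lemma gen_surj_lt i (f : submod_type K) : supported A^o (lt i) (kval f) ->
  exists2 p, supported A^o (ltY i) p & phi p = f.
Proof.
move=> f_lt; have [f0|[j jf f_le]] := dsum_top Rwo id (kval f).
  exists 0; first exact: submod0.
  by rewrite raddf0; apply: val_inj.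
have [p p_le pf] := gen_surj_le f_le; exists p => //.
apply: supportedW p_le => y yj; apply: (wo_lt_trans Rwo yj).
exact: mem_supported f_lt jf.
Qed.

Lemma gen_surj (f : submod_type K) : exists p, phi p = f.
Proof.
have [f0|[j jf f_le]] := dsum_top Rwo id (kval f).
  by exists 0; rewrite raddf0; apply: val_inj.
by have [p p_le pf] := gen_surj_le f_le; exists p.
Qed.

(** By the relation a i n = b i n * a i n.+1, the element
    k i n - b i n *: k i n.+1 has no entry at i, so it is a combination of
    generators of smaller index. *)
Lemma tails : exists l : Y -> dsum Y A^o, forall y,
  supported A^o (ltY y.1) (l y) /\
  phi (l y) = k y.1 y.2 - b y.1 y.2 *: k y.1 y.2.+1.
Proof.
have /choice[l lP] : forall y : Y, exists l, supported A^o (ltY y.1) l /\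
  phi l = k y.1 y.2 - b y.1 y.2 *: k y.1 y.2.+1; last by exists l.
move=> [i n] /=; pose f := k i n - b i n *: k i n.+1.
have [|l l_lt lE] := @gen_surj_lt i f; last by exists l.
have fE : kval f = kval (k i n) - b i n *: kval (k i n.+1).
  by rewrite raddfB linearZ.
rewrite fE; apply: supported_lt_of_le; first exact/submodB/submodZ.
by rewrite dsumBE dsumZE !k_lead a_chain subrr.
Qed.

Variable l : Y -> dsum Y A^o.
Hypothesis l_lt : forall y, supported A^o (ltY y.1) (l y).
Hypothesis l_gen : forall y, phi (l y) = k y.1 y.2 - b y.1 y.2 *: k y.1 y.2.+1.

(** The relation between the generators k i n that lifts
    a i n = b i n * a i n.+1. *)
Definition syzygy (y : Y) : dsum Y A^o :=
  delta y 1 - b y.1 y.2 *: delta (y.1, y.2.+1) 1 - l y.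
Local Notation z := syzygy.

Lemma syzygy_le y : supported A^o (leY y.1) (z y).
Proof.
apply: submodB.
  by apply/submodB/submodZ; apply: supported_delta; apply: wo_refl.
by apply: supportedW (l_lt (y := y)) => y'; apply: wo_lt_le.
Qed.

Lemma syzygy_row i n m : z (i, n) `@ (i, m) =
  (if m == n then 1 else 0) - b i n * (if m == n.+1 then 1 else 0).
Proof.
rewrite !dsumBE dsumZE !deltaE (l_lt (y := (i, n))) ?negbK ?wo_refl // subr0.
by rewrite !xpair_eqE eqxx.
Qed.

Lemma pure_regular (p : dsum Y A^o) (c : A) : pure p (c : A^o) = c *: p.
Proof. by apply/dsumP => y; rewrite pureE dsumZE -[LHS]/(_ * _) mulrC. Qed.

Lemma gen_syzygy q : phi (mx_act z A^o q) = 0.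
Proof.
apply: (@dsum_linear_ext _ _ _ _ (fun q => phi (mx_act z A^o q))
  (fun=> 0)) => [c p p'|c p p'|[i n] c].
- by rewrite !linearP.
- by rewrite scaler0 addr0.
have z0 : phi (z (i, n)) = 0.
  rewrite /syzygy !genB genZ !gen_delta l_gen /= !scale1r.
  exact: subrr.
by rewrite mx_act_delta pure_regular genZ z0 scaler0.
Qed.

Lemma syz_delta y c : mx_act z A^o (delta y c) = (c : A) *: z y.
Proof. by rewrite mx_act_delta pure_regular. Qed.

Definition im_syz : submodule (dsum Y A^o) := im_submod (mx_act z A^o).

Lemma gen_im p : im_syz p -> phi p = 0.
Proof. by case=> q <-; apply: gen_syzygy. Qed.

(** The terms of index smaller than i do not reach the position i, so only the
    entry (i, m) contributes there. *)
Lemma gen_lead i p m : supported A^o (leY i) p ->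
  (forall n, n != m -> p `@ (i, n) = 0) ->
  kval (phi p) `@ i = p `@ (i, m) * a i m.
Proof.
move=> p_le pm; pose c : A := p `@ (i, m).
have p'_lt : supported A^o (ltY i) (p - c *: delta (i, m) 1).
  move=> [j n]; rewrite negbK /= => ij; rewrite dsumBE dsumZE deltaE.
  have [ji|ji] := boolP (R j i); last first.
    rewrite (p_le (j, n)) //; case: eqP => [[ji' _]|_].
      by rewrite ji' wo_refl in ji.
    by rewrite scaler0 subr0.
  have -> : j = i by apply: (wo_anti Rwo); rewrite ij ji.
  rewrite xpair_eqE eqxx /=; have [->|/pm ->] := eqVneq n m.
    by rewrite -[_ *: _]/(_ * _) mulr1 subrr.
  by rewrite scaler0 subr0.
have -> : phi p = phi (p - c *: delta (i, m) 1) + c *: k i m.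
  by rewrite genB genZ gen_delta scale1r subrK.
by rewrite addrC val_eval_linear gen_lt // addr0 k_lead.
Qed.

(** Each syzygy of row i trades the entry at (i, m) for one at (i, m.+1); the
    entries of the row are pushed to the right until the last one, at M,
    remains and can be removed. *)
Lemma row_reduction i p M : supported A^o (leY i) p -> phi p = 0 ->
  (forall n, (M < n)%N -> p `@ (i, n) = 0) ->
  forall m, (m <= M.+1)%N -> exists p', [/\ im_syz (p - p'),
    supported A^o (leY i) p' &
    forall n, (n < m)%N || (M < n)%N -> p' `@ (i, n) = 0].
Proof.
move=> p_le p0 pM; elim=> [_|m IHm mM].
  by exists p; rewrite subrr; split=> //; apply: submod0.
have [p' [im_p' p'_le p'0]] := IHm (ltnW mM).
pose c : A := p' `@ (i, m).
exists (p' - c *: z (i, m)); split.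
- rewrite opprB addrCA addrC; apply: submodD => //; apply: submodZ.
  exists (delta (i, m) 1); by rewrite syz_delta scale1r.
- exact/submodB/submodZ/(syzygy_le (y := (i, m))).
move=> n nmM; rewrite dsumBE dsumZE syzygy_row.
have [->|nm] := eqVneq n m.
  by rewrite ltn_eqF // mulr0 subr0 -[_ *: _]/(_ * _) mulr1 subrr.
rewrite p'0; last by rewrite ltnS leq_eqVlt (negbTE nm) in nmM.
case: eqP => [nE|_]; last by rewrite mulr0 subrr scaler0 subrr.
rewrite nE ltnn /= in nmM; have {nmM mM} mE : m = M.
  by apply/eqP; rewrite eqn_leq -ltnS mM.
(* The row is concentrated at M, so its value at i is c * a i M. As p' maps to
   zero this value is zero, and the last syzygy creates no entry at M.+1. *)
have ca : c * a i m = 0.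
  rewrite -gen_lead //.
    have -> : p' = p - (p - p') by rewrite opprB addrC subrK.
    by rewrite raddfB /= p0 (gen_im im_p') subrr.
  by move=> n' n'm; apply: p'0; rewrite -mE -neq_ltn.
rewrite mulr1 !sub0r scalerN opprK; exact: a_reg ca.
Qed.

(** Row reduction clears the top row of a relation modulo the syzygies, and
    what is left has a smaller top row. *)
Lemma gen_ker p : phi p = 0 -> im_syz p.
Proof.
have le_case i : forall p, supported A^o (leY i) p -> phi p = 0 -> im_syz p.
  elim/(wo_ind Rwo): i => i IHi {}p p_le p0.
  pose M := \max_(y <- supp p) y.2.
  have pM n : (M < n)%N -> p `@ (i, n) = 0.
    move=> Mn; apply/eqP; apply: contraLR Mn; rewrite -mem_supp -leqNgt => np.
    by rewrite /M (big_rem _ np) /= leq_maxl.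
  have [p' [im_p' p'_le p'0]] := row_reduction p_le p0 pM (leqnn _).
  rewrite -[p](subrK p'); apply: submodD => //.
  have [->|[y yp' p'_top]] := dsum_top Rwo fst p'; first exact: submod0.
  apply: (IHi y.1) => //.
    have yi : R y.1 i := mem_supported p'_le yp'.
    apply/negP => iy; have ei : i = y.1 by apply: (wo_anti Rwo); rewrite iy.
    move: yp'; rewrite mem_supp [y]surjective_pairing -ei p'0 ?eqxx //.
    by rewrite ltnS leqNgt orNb.
  have -> : p' = p - (p - p') by rewrite opprB addrC subrK.
  by rewrite raddfB /= p0 (gen_im im_p') subrr.
have [-> _|[y yp p_top]] := dsum_top Rwo fst p; first exact: submod0.
exact: le_case p_top.
Qed.

Lemma mx_actE (N : lmodType A) q y0 :
  (mx_act z N q) `@ y0 = \sum_(y <- supp q) (z y `@ y0 : A) *: (q `@ y).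
Proof.
rewrite -[LHS](mklinearE (@dsum_eval_linear _ _ _ y0)) /mx_act dsum_liftE.
rewrite raddf_sum.
by apply: eq_bigr => y _; rewrite /= !mklinearE pureE.
Qed.

(** The syzygies form a triangular matrix with unit diagonal, when rows i are
    compared by the well-order and positions n in a row by the reverse order
    of nat. Solving for the entries of q from the top row down, and from left
    to right in each row, never divides. *)
Lemma syzygy_saturated (N : lmodType A) (W : submodule N) q :
  (forall y, W ((mx_act z N q) `@ y)) -> forall y, W (q `@ y).
Proof.
move=> Wq; pose bad := [seq y <- supp q | ~~ `[< W (q `@ y) >]].
have badP y : ~ W (q `@ y) -> y \in bad.
  move=> NWy; rewrite mem_filter mem_supp; apply/andP; split.
    exact/asboolPn.
  by apply/eqP => q0; apply: NWy; rewrite q0; apply: submod0.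
have [bad0|bad0] := eqVneq [seq y.1 | y <- bad] [::].
  move=> y; apply: contrapT => /badP; by move: bad0; case: (bad).
have [i /mapP[[i' n0] badi /= ei] iR] := wo_max Rwo (elimN eqP bad0); subst i'.
(* The first bad position (i, n): highest row, then smallest n. Every other
   syzygy that meets it has its coefficient in W. *)
have exn : exists n, ~~ `[< W (q `@ (i, n)) >].
  by exists n0; move: badi; rewrite mem_filter => /andP[].
case: (ex_minnP exn) => n /asboolPn NWn nmin; case: NWn.
pose c := q `@ (i, n); pose q' := q - delta (i, n) c.
have -> : q `@ (i, n) = (mx_act z N q) `@ (i, n) - (mx_act z N q') `@ (i, n).
  rewrite /q' raddfB /= dsumBE opprB addrC subrK mx_act_delta pureE.
  by rewrite syzygy_row eqxx ltn_eqF // mulr0 subr0 scale1r.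
apply: submodB => //; rewrite mx_actE; apply: submod_sum => -[j m] _.
have [q'E|NWq'] := pselect (W (q' `@ (j, m))); first exact: submodZ.
have jm : (j, m) != (i, n).
  apply/eqP => jm; apply: NWq'; rewrite jm dsumBE deltaE eqxx subrr.
  exact: submod0.
have {}NWq' : ~ W (q `@ (j, m)).
  by move: NWq'; rewrite dsumBE deltaE (negbTE jm) subr0.
have ji : R j i by apply: iR; apply/mapP; exists (j, m) => //; apply: badP.
have [ij|ij] := boolP (R i j); last first.
  rewrite (syzygy_le (y := (j, m))) ?scale0r //; exact: submod0.
have {ij} e : j = i by apply: (wo_anti Rwo); rewrite ij ji.
subst j; have nm : (n < m)%N.
  rewrite ltn_neqAle nmin ?andbT.
    by rewrite eq_sym; move: jm; rewrite xpair_eqE eqxx.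
  exact/asboolPn.
rewrite syzygy_row !ltn_eqF ?mulr0 ?subrr ?scale0r //; first exact: submod0.
exact: ltnW.
Qed.

End LeadingTerms.

(** Every ideal is the direct limit of A -b 0-> A -b 1-> A -> ..., via the
    elements a n. The last clause makes the limit map to A injective; in a
    domain it holds when a n is nonzero, and for a n = 0 it forces b n = 0. *)
Definition telescopic_ideals (A : comNzRingType) : Prop :=
  forall I : submodule A^o, exists a b : nat -> A,
    [/\ forall n, I (a n),
        forall x, I x -> exists n r, x = r * a n,
        forall n, a n = b n * a n.+1
      & forall n c, c * a n = 0 -> c * b n = 0].

Section Presentation.
Variables (A : comNzRingType) (A_tele : telescopic_ideals A).

(** Filter K by the index of the leading entry. The leading coefficients at i
    form an ideal, which is the limit of a telescope; lifting its generators
    and relations at every i presents K by a square matrix. This is the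
    argument for submodules of free modules over a hereditary ring, with the
    projective ideals replaced by telescopes. *)
Lemma submodule_presentation (X : eqType) (K : submodule (dsum X A^o)) :
  exists (z : X * nat -> dsum (X * nat)%type A^o)
         (phi : {linear dsum (X * nat)%type A^o -> submod_type K}),
    [/\ forall f, exists p, phi p = f,
        forall p, phi p = 0 <-> exists q, mx_act z A^o q = p
      & forall (N : lmodType A) (W : submodule N) q,
          (forall y, W ((mx_act z N q) `@ y)) -> forall y, W (q `@ y)].
Proof.
have [R Rwo] := well_ordering_principle X.
pose lead_pred i (c : A^o) := exists f, [/\ K f,
  supported A^o (fun j => R j i) f & f `@ i = c].
have lead0 i : lead_pred i 0.
  by exists 0; split=> //; apply: submod0.
have leadP i c x y : lead_pred i x -> lead_pred i y -> lead_pred i (c *: x + y).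
  move=> [f [Kf f_le fx]] [g [Kg g_le gy]]; exists (c *: f + g).
  by split; [exact: submodP|exact: submodP|rewrite dsumE fx gy].
pose lead i : submodule A^o := Submodule (lead0 i) (leadP i).
have [a /choice[b abP]] := choice (fun i => A_tele (lead i)).
have /choice[k0 k0P] : forall y : X * nat, exists f : submod_type K,
    supported A^o (fun j => R j y.1) (submod_val f) /\
    submod_val f `@ y.1 = a y.1 y.2.
  move=> [i n]; have [aI _ _ _] := abP i.
  by have [f [Kf f_le fi]] := aI n; exists (submod_mk Kf).
pose k i n := k0 (i, n).
have k_le i n := (k0P (i, n)).1; have k_lead i n := (k0P (i, n)).2.
have a_gen i f : K f -> supported A^o (fun j => R j i) f ->
    exists n r, f `@ i = r * a i n.
  by move=> Kf f_le; case: (abP i) => _ + _ _; apply; exists f.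
have a_chain i n : a i n = b i n * a i n.+1 by case: (abP i).
have a_reg i n c : c * a i n = 0 -> c * b i n = 0.
  by case: (abP i) => _ _ _; apply.
have [l lP] := tails Rwo (k := k) k_le k_lead a_gen a_chain.
have l_lt y := (lP y).1; have l_gen y := (lP y).2.
exists (syzygy b l), (gen_map k); split.
- exact: (gen_surj Rwo k_le k_lead a_gen).
- move=> p; split; last by case=> q <-; apply: (gen_syzygy l_gen).
  exact: (gen_ker Rwo k_le k_lead a_reg l_lt l_gen).
- move=> N W q; exact: (syzygy_saturated Rwo l_lt).
Qed.

End Presentation.

(** * Upper bounds on the dimensions *)

Section UpperBounds.
Variables (A : comNzRingType) (A_tele : telescopic_ideals A).

Definition free_cover (M : lmodType A) : {linear dsum M A^o -> M} :=
  dsum_lift (fun m => mklinear (scale_const_linear m)).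

Lemma free_cover_surj (M : lmodType A) m : exists p, free_cover M p = m.
Proof.
exists (delta m 1); rewrite /free_cover dsum_lift_delta mklinearE.
exact: scale1r.
Qed.

Lemma has_projective_resolution2 (M : lmodType A) :
  has_resolution (@projective_module A) M 2.
Proof.
pose K := ker_submod (free_cover M).
have [z [phi [phi_surj phi_ker saturated]]] := submodule_presentation A_tele K.
have d0_lin : linear (fun p => submod_val (phi p)).
  by move=> c p q; rewrite !linearP.
apply: (@resolution_of_three_terms _ _ _ _ _ _ (free_cover M)
  (mklinear d0_lin) (mx_act z A^o)) => //; try exact: dsum_projective.
- exact: free_cover_surj.
- move=> f; split=> [Kf|[p <-]]; last first.
    rewrite (mklinearE d0_lin). exact: (submod_val_in (phi p)).
  have [p pf] := phi_surj (submod_mk (W := K) Kf).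
  by exists p; rewrite mklinearE pf.
- move=> p; rewrite mklinearE -phi_ker; split=> [p0|->]; last exact: raddf0.
  by apply: val_inj; rewrite /= p0.
- exact/mx_act_injective_of_saturated/saturated.
Qed.

Lemma has_flat_resolution1 (M : lmodType A) :
  has_resolution (@flat_module A) M 1.
Proof.
pose K := ker_submod (free_cover M).
have [z [phi [phi_surj phi_ker saturated]]] := submodule_presentation A_tele K.
apply: (@resolution_of_three_terms _ _ _ _ _ (zero_mod A) (free_cover M)
  (@submod_val _ _ K) (zero_linear _ _)) => //; try exact: dsum_flat.
- by move=> _ x; apply: zero_modP.
- exact: flat_of_presentation phi_surj phi_ker saturated.
- exact: free_cover_surj.
- move=> f; split=> [Kf|[k <-]]; last exact: (submod_val_in k).
  by exists (submod_mk (W := K) Kf).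
- move=> k; split=> [k0|[y <-]]; last by rewrite (zero_modP y) !raddf0.
  by exists 0; rewrite raddf0; apply: val_inj.
- by move=> x _; apply: zero_modP.
Qed.

End UpperBounds.

(** * Lower bounds on the dimensions *)

Section LowerBounds.
Variable A : comNzRingType.

Lemma mult_linear (t : A) : linear (fun c : A^o => (t * c : A^o)).
Proof.
by move=> c x y; rewrite mulrDr; congr (_ + _); apply: mulrCA.
Qed.

Definition unit_pairing (P : lmodType A) (p : P) (c : A^o) : P := (c : A) *: p.

Lemma unit_pairing_bilinear (P : lmodType A) :
  bilinear_for *:%R *:%R (@unit_pairing P).
Proof.
split=> [c a p q|p a c d]; rewrite /unit_pairing.
  by rewrite /= scalerDr !scalerA mulrC.
by rewrite /= scalerDl scalerA.
Qed.

HB.instance Definition _ (P : lmodType A) := bilinear_isBilinear.Build A P A^o P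
  *:%R *:%R (@unit_pairing P) (unit_pairing_bilinear P).

(** Flatness turns the injection t : A -> A into an injection of P =
    P (x) A. *)
Lemma flat_torsion_free (P : lmodType A) (t : A) :
  (forall c, c * t = 0 -> c = 0) -> flat_module P ->
  forall p : P, t *: p = 0 -> p = 0.
Proof.
move=> t_reg P_flat p tp.
pose f := mklinear (mult_linear t).
have f_inj : injective f.
  move=> c d; rewrite !mklinearE => /eqP.
  rewrite -subr_eq0 -mulrBr mulrC => /eqP/t_reg/eqP.
  by rewrite subr_eq0 => /eqP.
have p1 : tens_pure p (1 : A^o) = 0.
  apply: (P_flat _ _ f f_inj); rewrite raddf0 tens_mapE mklinearE.
  have -> : t * (1 : A^o) = t *: (1 : A^o) by [].
  by rewrite linearZr_LR -linearZl_LR /= tp linear0l.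
have := tens_liftE (@unit_pairing P) p 1; rewrite p1 raddf0 /= => p0.
by rewrite -[p]scale1r.
Qed.

(** The module A / tA is nonzero and killed by t, hence not flat. *)
Lemma no_flat_resolution0 (t : A) :
  (forall c, c * t = 0 -> c = 0) -> (forall r, r * t <> 1) ->
  exists M : lmodType A, ~ has_resolution (@flat_module A) M 0.
Proof.
move=> t_reg t_nonunit; pose I := im_submod (mklinear (mult_linear t)).
exists (quot_mod I) => -[P [d [eps [P_flat P0 surj e0 e1]]]].
have eps_inj p : eps p = 0 -> p = 0.
  by move=> /e0[y <-]; rewrite (P0 1%N isT y) raddf0.
have [p pE] := surj (quot_pi I 1).
have p0 : p = 0.
  apply: (flat_torsion_free t_reg (P_flat 0%N)); apply: eps_inj.
  rewrite linearZ /= pE -linearZ; apply/quot_pi0; exists 1; rewrite mklinearE.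
  by [].
have /quot_pi0[r] : quot_pi I 1 = 0 by rewrite -pE p0 raddf0.
by rewrite mklinearE mulrC; apply: t_nonunit.
Qed.

Section ProjDim2.
Variables a b : nat -> A.
Hypothesis a_chain : forall n, a n = b n * a n.+1.
Hypothesis a_reg : forall n c, c * a n = 0 -> c = 0.
Hypothesis b_nonunit : forall n r, r * b n <> 1.

Lemma chain_le n m : (n <= m)%N -> exists r, a n = r * a m.
Proof.
move/subnK <-; elim: (m - n)%N => [|k [r rE]]; first by exists 1; rewrite mul1r.
by exists (r * b (k + n)); rewrite rE a_chain mulrA.
Qed.

Definition chain_ideal : submodule A^o.
Proof.
exists (fun x : A => exists n r, x = r * a n) => [|c x y [n [r ->]] [m [s ->]]].
  by exists 0, 0; rewrite mul0r.
have [r' rE] := chain_le (leq_maxl n m).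
have [s' sE] := chain_le (leq_maxr n m).
exists (maxn n m), (c * r * r' + s * s').
by rewrite rE sE mulrDl -[c *: _]/(c * _) !mulrA.
Defined.
Local Notation I := chain_ideal.

Lemma chain_in n : I (a n).
Proof. by exists n, 1; rewrite mul1r. Qed.

Definition chain_gen n : submod_type I := submod_mk (chain_in n).

Definition chain_cover : {linear dsum nat A^o -> submod_type I} :=
  dsum_lift (fun n => mklinear (scale_const_linear (chain_gen n))).

Lemma chain_cover_surj x : exists p, chain_cover p = x.
Proof.
have [n [r rE]] := submod_val_in x; exists (delta n (r : A^o)).
by rewrite /chain_cover dsum_lift_delta mklinearE; apply: val_inj.
Qed.

(** All values of a section s are supported in the support of s (a 0): up to
    the nonzero factor a 0 they are multiples of it. The union of the ideals
    (a n) would then be one of them, against the strictness of the chain. *)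
Lemma chain_cover_not_split (s : {linear submod_type I -> dsum nat A^o}) :
  ~ (forall x, chain_cover (s x) = x).
Proof.
move=> sK; pose x0 := chain_gen 0; pose m := \max_(n <- supp (s x0)) n.
have s_supp x n : n \in supp (s x) -> n \in supp (s x0).
  rewrite !mem_supp; apply: contraNN => /eqP s0; apply/eqP.
  have e : a 0%N *: x = (submod_val x : A) *: x0.
    by apply: val_inj; rewrite /= -[LHS]/(_ * _) -[RHS]/(_ * _) mulrC.
  have {}e : a 0%N *: s x = (submod_val x : A) *: s x0.
    have sZ c y : s (c *: y) = c *: s y by exact: linearZ.
    by rewrite -!sZ e.
  apply: (@a_reg 0); rewrite mulrC -[_ * _]/(a 0%N *: (s x `@ n)) -dsumZE e.
  by rewrite dsumZE s0 scaler0.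
have W0 : exists r, submod_val (0 : submod_type I) = r * a m.
  by exists 0; rewrite mul0r.
have WP c (x y : submod_type I) : (exists r, submod_val x = r * a m :> A) ->
    (exists r, submod_val y = r * a m :> A) ->
    exists r, submod_val (c *: x + y) = r * a m.
  move=> [r rE] [r' r'E]; exists (c * r + r').
  by rewrite linearP /= rE r'E mulrDl -mulrA.
have [r rE] : exists r, submod_val (chain_gen m.+1) = r * a m.
  rewrite -[chain_gen _]sK /chain_cover dsum_liftE.
  apply: (submod_sum (W := Submodule W0 WP)) => n /s_supp ns /=.
  have /chain_le[r rE] : (n <= m)%N by rewrite /m (big_rem _ ns) /= leq_maxl.
  exists ((s (chain_gen m.+1) `@ n : A) * r).
  by rewrite mklinearE linearZ /= rE -mulrA.
apply: (@b_nonunit m r); apply/eqP; rewrite -subr_eq0; apply/eqP.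
apply: (@a_reg m.+1); rewrite mulrBl mul1r -mulrA -a_chain -rE.
exact: subrr.
Qed.

(** A resolution 0 -> P1 -> P0 -> A / I would split the telescope cover of I.
    Comparing P0 with A in both directions yields c congruent to 1 modulo I
    such that multiplication by c on I factors through P1, hence lifts to the
    cover; multiplication by 1 - c lifts because 1 - c is in I. The sum is a
    section. *)
Lemma no_projective_resolution1 :
  ~ has_resolution (@projective_module A) (quot_mod I) 1.
Proof.
move=> [P [d [eps [P_proj P0 surj e0 e1]]]].
have d_inj y : d 0%N y = 0 -> y = 0.
  by move=> /e1[w <-]; rewrite (P0 2%N isT w) raddf0.
have [p0 p0E] := surj (quot_pi I 1).
(* h compares P0 with A over A / I; in the other direction 1 goes to p0, and
   c is the composite A -> P0 -> A. *)
have [h hE] := P_proj 0%N _ _ (quot_pi I) eps (fun y =>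
  let: ex_intro x e := quot_surj y in ex_intro _ x (esym e)).
pose c : A := h p0.
have quotE (x : A^o) : quot_pi I x = (x : A) *: quot_pi I 1.
  by rewrite -linearZ; congr quot_pi; rewrite -[RHS]/(_ * _) mulr1.
have [w wE] : exists w, submod_val (chain_cover w) = 1 - c.
  have Ic : I (1 - c) by apply/quot_piP; rewrite hE.
  by have [w wE] := chain_cover_surj (submod_mk Ic); exists w; rewrite wE.
(* g x is the element of P1 above x *: p0, for x in I. *)
have /choice[g gE] : forall x : submod_type I, exists y,
    d 0%N y = (submod_val x : A) *: p0.
  move=> x; apply/e0; rewrite linearZ /= p0E -quotE.
  exact/quot_pi0/submod_val_in.
have g_lin : linear g.
  move=> r x y; apply/eqP; rewrite -subr_eq0; apply/eqP; apply: d_inj.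
  by rewrite raddfB /= linearP /= !gE linearP /= scalerDl scalerA subrr.
have hd_in y : I (h (d 0%N y)).
  by apply/quot_pi0; rewrite hE; apply/e0; exists y.
have hd_lin : linear (fun y => submod_mk (hd_in y)).
  by move=> r x y; apply: val_inj; rewrite /= !linearP.
have [th thE] := P_proj 1%N _ _ chain_cover (mklinear hd_lin) chain_cover_surj.
have s_lin : linear (fun x : submod_type I =>
    (submod_val x : A) *: w + th (g x)).
  move=> r x y; rewrite g_lin.
  have -> : th (r *: g x + g y) = r *: th (g x) + th (g y) by exact: linearP.
  have -> : submod_val (r *: x + y) = r * submod_val x + submod_val y by [].
  by rewrite scalerDl -scalerA scalerDr addrACA.
apply: (@chain_cover_not_split (mklinear s_lin)) => x.
have cP : chain_cover ((submod_val x : A) *: w + th (g x)) =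
    (submod_val x : A) *: chain_cover w + chain_cover (th (g x)).
  exact: linearP.
rewrite (mklinearE s_lin) cP thE (mklinearE hd_lin); apply: val_inj.
rewrite /= wE gE linearZ /= -[LHS]/(_ * (1 - c) + _ * c).
by rewrite -mulrDr subrK mulr1.
Qed.

End ProjDim2.
End LowerBounds.

(** * Countable Bezout domains *)

Section CountableBezout.
Variable A : comNzRingType.
Hypothesis A_domain : forall x y : A, x * y = 0 -> x = 0 \/ y = 0.
Hypothesis A_bezout : forall x y : A, exists d,
  [/\ exists u v, d = u * x + v * y,
      exists x', x = x' * d & exists y', y = y' * d].
Variable g : nat -> A.
Hypothesis g_surj : forall x, exists n, x = g n.

(** Enumerate the ring and let a n generate the ideal spanned by those of the
    first n elements that lie in I. *)
Lemma telescopic_of_countable_bezout : telescopic_ideals A.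
Proof.
move=> I.
have /choice[D DP] : forall xy : A * A, exists d,
    [/\ exists u v, d = u * xy.1 + v * xy.2, exists x', xy.1 = x' * d
      & exists y', xy.2 = y' * d] by move=> [x y]; apply: A_bezout.
pose e n := if `[< I (g n) >] then g n else 0.
have eI n : I (e n) by rewrite /e; case: asboolP => // _; apply: submod0.
pose a := fix a n := if n is m.+1 then D (a m, e m) else 0.
have aS n : a n.+1 = D (a n, e n) by [].
have aI n : I (a n).
  elim: n => [|n IHn]; first exact: submod0.
  rewrite aS; have [[u [v ->]] _ _] := DP (a n, e n).
  exact: (submodD (submodZ u IHn) (submodZ v (eI n))).
(* When a n = 0 the quotient of a n by a n.+1 must be chosen to be zero. *)
have /choice[b bP] : forall n, exists b, a n = b * a n.+1 /\ (a n = 0 -> b = 0).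
  move=> n; have [an0|an0] := pselect (a n = 0).
    by exists 0; rewrite an0 mul0r.
  by rewrite aS; have [_ [b /= bE] _] := DP (a n, e n); exists b.
exists a, b; split=> // [x Ix|n|n c ca].
- have [n xE] := g_surj x; have [_ _ [y' /= yE]] := DP (a n, e n).
  exists n.+1, y'; rewrite aS -yE /e -xE.
  by case: asboolP.
- by have [] := bP n.
have [c0|an0] := A_domain ca; first by rewrite c0 mul0r.
by have [_ ->] := bP n; rewrite ?mulr0.
Qed.

End CountableBezout.

(** * The perfect closure as a union of polynomial rings *)

Section PerfectClosure.
Variables (L : fieldType) (iota : {rmorphism {fraction {poly 'F_2}} -> L}).
Variables (s : L) (hs : s ^+ 2 = F2t_var iota + 1).

Local Notation t := (F2t_var iota).
Local Notation cst := (F2t_cst iota).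
Local Notation R := (adjoin2 cst t (t * s)).
Variable chR : 2%N \in [pchar R].
Local Notation A := (tele_lim (pFrobenius_aut chR)).

(** The subring F_2[t] of L; it is isomorphic to F_2[X] since t is
    transcendental. *)
Definition at_t (p : {poly 'F_2}) : L := (map_poly cst p).[t].

Lemma at_tE p : at_t p = iota (FracField.tofrac p).
Proof.
rewrite /at_t -[in RHS](comp_polyXr p) /comp_poly -!horner_map -!map_poly_comp.
by congr (_.[_]); apply: eq_map_poly.
Qed.

Lemma at_t_zmod : zmod_morphism at_t.
Proof. by move=> p q; rewrite !at_tE !rmorphB. Qed.
Lemma at_t_monoid : monoid_morphism at_t.
Proof. by split=> [|p q]; rewrite !at_tE ?rmorph1 ?rmorphM. Qed.
HB.instance Definition _ := GRing.isZmodMorphism.Build _ L at_t at_t_zmod.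
HB.instance Definition _ := GRing.isMonoidMorphism.Build _ L at_t at_t_monoid.

Lemma at_t_in p : at_t p \in adjoin2_pred cst t (t * s).
Proof.
apply/asboolP; exists (map_poly polyC p).
rewrite -map_poly_comp (eq_map_poly (g := polyC \o cst)); last first.
  by move=> c /=; rewrite map_polyC.
by rewrite map_poly_comp horner_map hornerC.
Qed.

Definition poly_t (p : {poly 'F_2}) : R := Adjoin2 (at_t_in p).

Lemma poly_t_zmod : zmod_morphism poly_t.
Proof. by move=> p q; apply: val_inj; rewrite /= rmorphB. Qed.
Lemma poly_t_monoid : monoid_morphism poly_t.
Proof. by split=> [|p q]; apply: val_inj; rewrite /= ?rmorph1 ?rmorphM. Qed.
HB.instance Definition _ := GRing.isZmodMorphism.Build _ R poly_t poly_t_zmod.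
HB.instance Definition _ :=
  GRing.isMonoidMorphism.Build _ R poly_t poly_t_monoid.

Lemma poly_t_eq0 p : poly_t p = 0 -> p = 0.
Proof.
move/(congr1 (@adjoin2_val _ _ _ _ _)) => /= /eqP.
by rewrite at_tE fmorph_eq0 tofrac_eq0 => /eqP.
Qed.

Lemma pchar_L : 2%N \in [pchar L].
Proof. by rewrite (rmorph_pchar cst) // pchar_F2. Qed.

Lemma sqrD_L (x y : L) : (x + y) ^+ 2 = x ^+ 2 + y ^+ 2.
Proof. exact: (pFrobenius_autD_comm pchar_L (mulrC x y)). Qed.

(** The squares of the two generators are t^2 and (t s)^2 = t^2 (t + 1), and
    in characteristic 2 the elements with square in F_2[t] form a subring. *)
Lemma sqr_poly_t (r : R) : exists p, r ^+ 2 = poly_t p.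
Proof.
suff [p pE] : exists p, adjoin2_val r ^+ 2 = at_t p.
  by exists p; apply: val_inj; rewrite rmorphXn.
case: r => _ /= /asboolP[P ->].
have at_tX : at_t 'X = t by rewrite at_tE.
elim/poly_ind: P => [|P C [p pE]].
  by exists 0; rewrite !rmorph0 !horner0 expr0n.
have [q qE] : exists q, (map_poly cst C).[t * s] ^+ 2 = at_t q.
  elim/poly_ind: C => [|C c [q qE]].
    by exists 0; rewrite !rmorph0 horner0 expr0n.
  exists (q * ('X ^+ 2 * ('X + 1)) + (c ^+ 2)%:P).
  rewrite rmorphD rmorphM /= map_polyX map_polyC.
  rewrite hornerD hornerM hornerX hornerC.
  rewrite sqrD_L !exprMn qE hs [RHS]rmorphD /=.
  rewrite !(rmorphM at_t) (rmorphD at_t) (rmorph1 at_t).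
  by rewrite /= !at_tX -expr2 (at_tE _%:P) !rmorphXn.
exists (p * 'X ^+ 2 + q).
rewrite rmorphD rmorphM /= map_polyX map_polyC.
rewrite !(hornerD, hornerM, hornerX, hornerC).
rewrite sqrD_L exprMn pE qE [RHS]rmorphD !(rmorphM at_t).
by rewrite /= at_tX -expr2.
Qed.

(** The polynomial p evaluated at the root of order 2^n of t: the Frobenius
    map is the identity on F_2, so p (t) in the n-th copy of R represents
    p (t^(1/2^n)). *)
Definition level (n : nat) (p : {poly 'F_2}) : A := tele_in _ n (poly_t p).
HB.instance Definition _ n := GRing.RMorphism.copy (level n)
  (tele_in (pFrobenius_aut chR) n \o poly_t).

Lemma levelS n p : level n p = level n.+1 (p ^+ 2).
Proof. by rewrite /level -tele_inS; congr tele_in; rewrite rmorphXn. Qed.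

Lemma level_le n m p : (n <= m)%N -> level n p = level m (p ^+ (2 ^ (m - n))).
Proof.
move/subnK => {1}<-; elim: (m - n)%N => [|k IHk]; first by rewrite expr1.
by rewrite IHk levelS -exprM addSn expnSr.
Qed.

Lemma level_surj x : exists n p, x = level n p.
Proof.
have [n [r ->]] := tele_in_surj x; have [p pE] := sqr_poly_t r.
by exists n.+1, p; rewrite /level -pE -(tele_inS (pFrobenius_aut chR) n r).
Qed.

Lemma level_surj2 x y : exists n p q, x = level n p /\ y = level n q.
Proof.
have [n [p ->]] := level_surj x; have [m [q ->]] := level_surj y.
exists (maxn n m), (p ^+ (2 ^ (maxn n m - n))), (q ^+ (2 ^ (maxn n m - m))).
by rewrite -!level_le ?leq_maxl ?leq_maxr.
Qed.

Lemma level_eq0 n p : level n p = 0 -> p = 0.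
Proof.
move/tele_in_eq0 => [k]; elim: k => [|k IHk]; first exact: poly_t_eq0.
rewrite iterS => k0; apply: IHk; apply: val_inj; apply/eqP.
have : \val (iter k (pFrobenius_aut chR) (poly_t p)) ^+ 2 == 0.
  by rewrite -rmorphXn -(pFrobenius_autE chR) k0.
by rewrite expf_eq0.
Qed.

Lemma closure_domain (x y : A) : x * y = 0 -> x = 0 \/ y = 0.
Proof.
have [n [p [q [-> ->]]]] := level_surj2 x y.
rewrite -rmorphM => /level_eq0/eqP; rewrite mulf_eq0.
by case/orP=> /eqP ->; rewrite rmorph0; [left|right].
Qed.

Lemma closure_bezout (x y : A) : exists d, [/\ exists u v, d = u * x + v * y,
  exists x', x = x' * d & exists y', y = y' * d].
Proof.
have [n [p [q [-> ->]]]] := level_surj2 x y.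
have [[u v] /= uvE] := Bezoutp p q; pose d := u * p + v * q.
have /dvdpP[p' p'E] : d %| p by rewrite (eqp_dvdl _ uvE) dvdp_gcdl.
have /dvdpP[q' q'E] : d %| q by rewrite (eqp_dvdl _ uvE) dvdp_gcdr.
exists (level n d); split.
- by exists (level n u), (level n v); rewrite rmorphD !rmorphM.
- by exists (level n p'); rewrite -rmorphM -p'E.
- by exists (level n q'); rewrite -rmorphM -q'E.
Qed.

Definition closure_enum (k : nat) : A :=
  if unpickle k is Some np then level np.1 np.2 else 0.

Lemma closure_enum_surj x : exists k, x = closure_enum k.
Proof.
have [n [p ->]] := level_surj x.
by exists (pickle (n, p)); rewrite /closure_enum pickleK.
Qed.

Lemma closure_telescopic : telescopic_ideals A.
Proof.
apply: (@telescopic_of_countable_bezout A _ _ closure_enum).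
- exact: closure_domain.
- exact: closure_bezout.
- exact: closure_enum_surj.
Qed.

(** After lifting to a common level this says that a power of X is not
    invertible in F_2[X]. *)
Lemma root_t_nonunit n r : r * level n 'X <> 1.
Proof.
have [m [p ->]] := level_surj r.
rewrite (level_le p (leq_maxl m n)) (level_le 'X (leq_maxr m n)).
move: (maxn m n) => k; move: (p ^+ _) => {}p.
rewrite -rmorphM -(rmorph1 (level k)) => /eqP; rewrite -subr_eq0 -rmorphB.
move=> /eqP/level_eq0/(congr1 (horner^~ 0)).
rewrite !hornerE expr0n expn_eq0 /= mulr0 sub0r => /eqP.
by rewrite oppr_eq0 oner_eq0.
Qed.

(** Hence the roots of t generate a strictly increasing chain of principal
    ideals. *)
Lemma root_t_chain n : level n 'X = level n.+1 'X * level n.+1 'X.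
Proof. by rewrite levelS rmorphXn. Qed.

Lemma root_t_regular n c : c * level n 'X = 0 -> c = 0.
Proof.
by case/closure_domain => // /level_eq0/eqP; rewrite polyX_eq0.
Qed.

Lemma closure_gl_dim : gl_dim A = Some 2%N.
Proof.
apply: least_spec => [M|m gl_m].
  exact/dim_le_resolution/(has_projective_resolution2 closure_telescopic).
rewrite ltnNge; apply/negP => m1.
have [] := no_projective_resolution1 (a_chain := root_t_chain) root_t_regular
  (fun n => @root_t_nonunit n.+1).
apply: (has_resolution_mono m1); apply/dim_le_resolution; exact: gl_m.
Qed.

Lemma closure_w_dim : w_dim A = Some 1%N.
Proof.
apply: least_spec => [M|m w_m].
  exact/dim_le_resolution/(has_flat_resolution1 closure_telescopic).
rewrite ltnNge leqn0; apply/negP => /eqP m0.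
have [||M []] := @no_flat_resolution0 A (level 0 'X).
- exact: root_t_regular.
- exact: root_t_nonunit.
by apply/dim_le_resolution; move: (w_m M); rewrite m0.
Qed.

End PerfectClosure.

(* L, with the embedding iota, is an algebraic closure of F_2(t), and s is a
   square root of t + 1 in L. *)
Theorem lemma7p2 (L : closedFieldType)
    (iota : {rmorphism {fraction {poly 'F_2}} -> L})
    (algL : forall z : L, algebraicOver iota z)
    (s : L) (hs : s ^+ 2 = F2t_var iota + 1) :
  let t := F2t_var iota in
  let R : comNzRingType := adjoin2 (F2t_cst iota) t (t * s) in
  let chR : 2%N \in [pchar R] := adjoin2_pchar _ _ _ pchar_F2 in
  let Roo : comNzRingType := perfect_closure chR in
  gl_dim Roo = Some 2%N /\ w_dim Roo = Some 1%N.
Proof. by split; [apply: closure_gl_dim|apply: closure_w_dim]. Qed.
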